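(* Let $M$ be a $\mathbb{Z}^k$-graded $R$-module and let $i_1,\dots,i_p$ be distinct elements of $\{1,\dots,k\}$. Then $$\hat{\mathbb{T}}^{i_1,\dots,i_p}(M)-\sum_{j=1}^p e_{i_j}\mathbb{N} \;=\; \mathbb{C}_{B_{i_1}+\cdots+B_{i_p}}(M)-\sum_{j=1}^p e_{i_j}\mathbb{N}.$$ As a consequence, $$\mathbb{C}_{B_{i_1}+\cdots+B_{i_p}}(M)^*=\hat{\mathbb{T}}^{i_1,\dots,i_p}(M)^*.$$
   Context: $S$ is an arbitrary commutative unitary ring, $k\ge 1$, $n_1,\dots,n_k\ge 1$, and $R=S[X_{i,j} : 1\le i\le k,\ 1\le j\le n_i]$ with its standard $\mathbb{Z}^k$-grading: elements of $S$ have degree $0$ and $\deg X_{i,j}=e_i$, the $i$-th canonical generator of $\mathbb{Z}^k$. $B_i=(X_{i,1},\dots,X_{i,n_i})$. Modules are not assumed finitely generated. For a finitely generated homogeneous ideal $I$, $H^i_I(M)$ is the $i$-th cohomology of the Čech complex of $M$ with respect to a finite homogeneous generating set of $I$. For a graded module $N$, $\operatorname{Supp}_{\mathbb{Z}^k}(N)=\{\gamma\in\mathbb{Z}^k : N_\gamma\ne 0\}$. $\mathbb{C}_I(M)=\bigcup_i \operatorname{Supp}_{\mathbb{Z}^k}(H^i_I(M))$. Set $a_{i_1,\dots,i_p}=-\sum_{j=1}^p n_{i_j}e_{i_j}$ and $\hat{\mathbb{T}}^{i_1,\dots,i_p}(M)=a_{i_1,\dots,i_p}+\bigcup_{j\ge0}\operatorname{Supp}_{\mathbb{Z}^k}\big(\operatorname{Tor}^R_j(M,R/(B_{i_1}+\cdots+B_{i_p}))\big)$.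 For subsets $E,F\subseteq\mathbb{Z}^k$, $E-F=\{e-f : e\in E, f\in F\}$; $E^*=E-\mathbb{N}^k$, with $\mathbb{N}=\mathbb{Z}_{\ge0}$; $\sum_{j=1}^p e_{i_j}\mathbb{N}$ is the set of all $\mathbb{N}$-linear combinations of $e_{i_1},\dots,e_{i_p}$. *)

(* Defs.v *)
From HB Require Import structures.
From mathcomp Require Import all_boot all_order all_algebra.
From mathcomp Require Import boolp classical_sets.
From mathcomp Require Import freeg mpoly.
From mathcomp Require Import zify.

Set Implicit Arguments.
Unset Strict Implicit.
Unset Printing Implicit Defensive.

Import GRing.Theory Num.Theory.
Local Open Scope classical_set_scope.
Local Open Scope ring_scope.
Local Open Scope quotient_scope.

Section Span.
Context (R : comNzRingType) (V : lmodType R).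
Implicit Types A : set V.

Definition span A : set V := [set x | exists2 s : seq (R * V),
  (forall q, q \in s -> A q.2) & x = \sum_(q <- s) q.1 *: q.2].

Definition spanb A : {pred V} := fun x => `[< span A x >].

Lemma spanb_submod_closed A : submod_closed (spanb A).
Proof.
split=> [|a x y /asboolP[s sA ->] /asboolP[t tA ->]].
  by apply/asboolP; exists [::] => //; rewrite big_nil.
apply/asboolP; exists ([seq (a * q.1, q.2) | q <- s] ++ t) => [q|].
  by rewrite mem_cat => /orP[/mapP[q' /sA q'A ->]|/tA].
rewrite big_cat big_map scaler_sumr; congr (_ + _).
by apply: eq_bigr => q _; rewrite scalerA.
Qed.

HB.instance Definition _ A :=
  GRing.isSubmodClosed.Build R V (spanb A) (spanb_submod_closed A).

Lemma spanD A x y : span A x -> span A y -> span A (x + y).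
Proof. by move=> /asboolP xA /asboolP yA; apply/asboolP; exact: (@rpredD V (spanb A)). Qed.

Lemma spanZ A a x : span A x -> span A (a *: x).
Proof. by move=> /asboolP xA; apply/asboolP; exact: (@rpredZ R V (spanb A)). Qed.

End Span.

Section Submodule.
Context (R : comNzRingType) (V : lmodType R) (A : set V).

(* A need not be a submodule: this is the submodule it generates *)
Record submodule := Submodule { submodule_val :> V; _ : spanb A submodule_val }.

HB.instance Definition _ := [isSub for submodule_val].
HB.instance Definition _ := [Choice of submodule by <:].
HB.instance Definition _ := [SubChoice_isSubZmodule of submodule by <:].
HB.instance Definition _ := [SubZmodule_isSubLmodule of submodule by <:].

End Submodule.

Section Quotient.
Context (R : comNzRingType) (V : lmodType R) (A : set V).

(* the quotient by the submodule generated by A *)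
Definition modquot : Type := Quotient.quot (spanb A).

HB.instance Definition _ := GRing.Zmodule.on modquot.
HB.instance Definition _ := EqQuotient.on modquot.

Definition qpi (x : V) : modquot := \pi_(Quotient.quot (spanb A)) x.

Lemma qpi_eq x y : (qpi x = qpi y) <-> span A (x - y).
Proof.
split=> [/eqP|/asboolP h]; last apply/eqP; rewrite /qpi -Quotient.idealrBE //.
by move/asboolP.
Qed.

Lemma qpiD x y : qpi (x + y) = qpi x + qpi y.
Proof. by rewrite /qpi !piE. Qed.

Lemma qpi_repr (u : modquot) : qpi (repr u) = u.
Proof. exact: reprK. Qed.

Definition qscale (a : R) (u : modquot) : modquot := qpi (a *: repr u).

Lemma qscale_pi a x : qscale a (qpi x) = qpi (a *: x).
Proof. by apply/qpi_eq; rewrite -scalerBr; apply/spanZ/qpi_eq/qpi_repr. Qed.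

Fact qscaleA a b u : qscale a (qscale b u) = qscale (a * b) u.
Proof. by rewrite -[u]qpi_repr !qscale_pi scalerA. Qed.
Fact qscale1 : left_id 1 qscale.
Proof. by move=> u; rewrite -[u]qpi_repr qscale_pi scale1r. Qed.
Fact qscaleDr : right_distributive qscale +%R.
Proof.
by move=> a u v; rewrite -[u]qpi_repr -[v]qpi_repr -qpiD !qscale_pi scalerDr qpiD.
Qed.
Fact qscaleDl u : {morph qscale^~ u : a b / a + b}.
Proof. by move=> a b; rewrite -[u]qpi_repr !qscale_pi scalerDl qpiD. Qed.

HB.instance Definition _ := GRing.Zmodule_isLmodule.Build R modquot
  qscaleA qscale1 qscaleDr qscaleDl.

Fact qpi_is_linear : linear qpi.
Proof. by move=> a x y; rewrite qpiD -qscale_pi. Qed.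

HB.instance Definition _ := GRing.isLinear.Build R V modquot *:%R qpi qpi_is_linear.

End Quotient.

Section DirectProduct.
Context (R : comNzRingType) (I : finType) (V : I -> lmodType R).

(* the product (equivalently, since I is finite, the direct sum) of the V i *)
Definition dprod : Type := {dffun forall i, V i}.

HB.instance Definition _ := Choice.on dprod.

Definition dprod_of (x : forall i, V i) : dprod := finfun x.
Definition dadd (x y : dprod) := dprod_of (fun i => x i + y i).
Definition dopp (x : dprod) := dprod_of (fun i => - x i).
Definition dscale (a : R) (x : dprod) := dprod_of (fun i => a *: x i).

Fact daddA : associative dadd.
Proof. by move=> x y z; apply/ffunP => i; rewrite !ffunE addrA. Qed.
Fact daddC : commutative dadd.
Proof. by move=> x y; apply/ffunP => i; rewrite !ffunE addrC. Qed.
Fact dadd0 : left_id (dprod_of (fun=> 0)) dadd.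
Proof. by move=> x; apply/ffunP => i; rewrite !ffunE add0r. Qed.
Fact daddN : left_inverse (dprod_of (fun=> 0)) dopp dadd.
Proof. by move=> x; apply/ffunP => i; rewrite !ffunE addNr. Qed.

HB.instance Definition _ := GRing.isZmodule.Build dprod daddA daddC dadd0 daddN.

Fact dscaleA a b x : dscale a (dscale b x) = dscale (a * b) x.
Proof. by apply/ffunP => i; rewrite !ffunE scalerA. Qed.
Fact dscale1 : left_id 1 dscale.
Proof. by move=> x; apply/ffunP => i; rewrite !ffunE scale1r. Qed.
Fact dscaleDr : right_distributive dscale +%R.
Proof. by move=> a x y; apply/ffunP => i; rewrite !ffunE scalerDr. Qed.
Fact dscaleDl x : {morph dscale^~ x : a b / a + b}.
Proof. by move=> a b; apply/ffunP => i; rewrite !ffunE scalerDl. Qed.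

HB.instance Definition _ := GRing.Zmodule_isLmodule.Build R dprod
  dscaleA dscale1 dscaleDr dscaleDl.

End DirectProduct.

Section Tensor.
Context (R : comNzRingType).
Implicit Types V W : lmodType R.

Definition bilinear_relations V W : set {freeg (V * W) / R} :=
  [set t | (exists x x' y, t = << (x + x', y) >> - << (x, y) >> - << (x', y) >>)
        \/ (exists x y y', t = << (x, y + y') >> - << (x, y) >> - << (x, y') >>)
        \/ (exists a x y, t = << (a *: x, y) >> - a *: << (x, y) >>)
        \/ (exists a x y, t = << (x, a *: y) >> - a *: << (x, y) >>)].

Definition tensor V W : lmodType R := modquot (@bilinear_relations V W).

Definition tens V W (x : V) (y : W) : tensor V W :=
  qpi (@bilinear_relations V W) << (x, y) >>.

(* f (x) id_W, computed on a representative of the class; see tensor_mapE *)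
Definition tensor_map V V' W (f : V -> V') (u : tensor V W) : tensor V' W :=
  fglift (fun p => tens (f p.1) p.2) (repr u).

Lemma tensDl V W x x' (y : W) : tens (x + x' : V) y = tens x y + tens x' y.
Proof.
rewrite /tens -qpiD; apply/qpi_eq; exists [:: (1, << (x + x', y) >> - << (x, y) >> - << (x', y) >>)].
  by move=> q; rewrite inE => /eqP ->; left; exists x, x', y.
by rewrite big_seq1 scale1r opprD addrA.
Qed.

Lemma tensDr V W x (y y' : W) : tens (x : V) (y + y') = tens x y + tens x y'.
Proof.
rewrite /tens -qpiD; apply/qpi_eq; exists [:: (1, << (x, y + y') >> - << (x, y) >> - << (x, y') >>)].
  by move=> q; rewrite inE => /eqP ->; right; left; exists x, y, y'.
by rewrite big_seq1 scale1r opprD addrA.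
Qed.

Lemma tensZl V W a x (y : W) : tens (a *: x : V) y = a *: tens x y.
Proof.
rewrite /tens -linearZ; apply/qpi_eq; exists [:: (1, << (a *: x, y) >> - a *: << (x, y) >>)].
  by move=> q; rewrite inE => /eqP ->; right; right; left; exists a, x, y.
by rewrite big_seq1 scale1r.
Qed.

Lemma tensZr V W a x (y : W) : tens (x : V) (a *: y) = a *: tens x y.
Proof.
rewrite /tens -linearZ; apply/qpi_eq; exists [:: (1, << (x, a *: y) >> - a *: << (x, y) >>)].
  by move=> q; rewrite inE => /eqP ->; right; right; right; exists a, x, y.
by rewrite big_seq1 scale1r.
Qed.

Fact fglift_linear (K : choiceType) V (h : K -> V) :
  linear (fglift h : {freeg K / R} -> V).
Proof.
pose L : {additive {freeg K / R} -> V} := HB.pack (fglift h : {freeg K / R} -> V)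
  (GRing.isZmodMorphism.Build {freeg K / R} V (fglift h) (lift_is_additive h)).
move=> a s t; rewrite -![fglift h _]/(L _) raddfD; congr (_ + _).
rewrite -{2}[s]freeg_sumE [a *: s]/(fgscale a s) /fgscale !raddf_sum /=.
by apply: eq_bigr => x _; rewrite !liftU scalerA.
Qed.

Lemma fglift_relations V V' W (f : {linear V -> V'}) t :
  span (@bilinear_relations V W) t ->
  fglift (fun p => tens (f p.1) p.2) t = 0 :> tensor V' W.
Proof.
pose L : {freeg (V * W) / R} -> tensor V' W := fglift (fun p => tens (f p.1) p.2).
pose Llin := GRing.isLinear.Build R _ _ _ L (fglift_linear _).
pose L' : {linear {freeg (V * W) / R} -> tensor V' W} := HB.pack L Llin.
move=> [s sA ->]; rewrite -[LHS]/(L' _) linear_sum big_seq big1 // => q /sA qA.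
rewrite linearZ; suff -> : L' q.2 = 0 by exact: scaler0.
have LU x y : L' << (x, y) >> = tens (f x) y by rewrite /= /L liftU scale1r.
case: qA => [|[|[|]]] => -[? [? [? ->]]];
  rewrite !linearB ?linearZ_LR !LU ?linearD ?linearZ_LR ?(tensDl, tensDr, tensZl, tensZr).
- by rewrite addrAC addrK; exact: subrr.
- by rewrite addrAC addrK; exact: subrr.
- rewrite scalerN; exact: subrr.
- rewrite scalerN; exact: subrr.
Qed.

Lemma tensor_mapE V V' W (f : {linear V -> V'}) (t : {freeg (V * W) / R}) :
  tensor_map f (qpi (@bilinear_relations V W) t)
  = fglift (fun p => tens (f p.1) p.2) t.
Proof.
rewrite /tensor_map; apply/eqP; rewrite -subr_eq0; apply/eqP.
rewrite -(lift_is_additive (fun p => tens (f p.1) p.2)).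
by apply: fglift_relations; apply/qpi_eq; rewrite qpi_repr.
Qed.

Lemma tensor_map_tens V V' W (f : {linear V -> V'}) x (y : W) :
  tensor_map f (tens x y) = tens (f x) y.
Proof. by rewrite tensor_mapE liftU scale1r. Qed.

End Tensor.

Section Localization.
Context (R : comNzRingType) (V : lmodType R) (f : R).

(* (x, m) stands for x / f ^+ m *)
Definition loc_eq : rel (V * nat) := fun x y =>
  `[< exists a, f ^+ (a + y.2) *: x.1 = f ^+ (a + x.2) *: y.1 >].

Fact loc_eq_equiv : equiv_class_of loc_eq.
Proof.
split=> [x|x y|y x z]; first by apply/asboolP; exists 0%N.
  by apply/asboolP/asboolP => -[a e]; exists a.
move=> /asboolP[a e1] /asboolP[b e2]; apply/asboolP; exists (a + b + y.2)%N.
have -> : (a + b + y.2 + z.2 = (b + z.2) + (a + y.2))%N by lia.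
have -> : (a + b + y.2 + x.2 = (a + x.2) + (b + y.2))%N by lia.
by rewrite exprD -scalerA e1 scalerA mulrC -scalerA e2 scalerA -exprD.
Qed.

Canonical loc_eq_equivRel := EquivRelPack loc_eq_equiv.
Canonical loc_eq_encModRel := defaultEncModRel loc_eq.

Definition loc : Type := {eq_quot loc_eq}.

HB.instance Definition _ := Choice.on loc.
HB.instance Definition _ := EqQuotient.on loc.

Definition frac (x : V) (m : nat) : loc := \pi_({eq_quot loc_eq}) (x, m).

Lemma frac_eq x m y n :
  (frac x m = frac y n) <-> exists a, f ^+ (a + n) *: x = f ^+ (a + m) *: y.
Proof.
split=> [/eqP|h]; last apply/eqP; rewrite /frac eqmodE.
  by move/asboolP.
exact/asboolP.
Qed.

Definition numer (u : loc) : V := (repr u).1.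
Definition expon (u : loc) : nat := (repr u).2.

Lemma frac_repr u : frac (numer u) (expon u) = u.
Proof. by rewrite /frac -surjective_pairing; exact: reprK. Qed.

Lemma frac_reprP x m :
  exists a, f ^+ (a + m) *: numer (frac x m) = f ^+ (a + expon (frac x m)) *: x.
Proof. exact/frac_eq/frac_repr. Qed.

Definition ladd (u v : loc) : loc :=
  frac (f ^+ expon v *: numer u + f ^+ expon u *: numer v) (expon u + expon v).
Definition lopp (u : loc) : loc := frac (- numer u) (expon u).
Definition lscale (a : R) (u : loc) : loc := frac (a *: numer u) (expon u).

Fact ladd_wdl x m x' m' y n : frac x m = frac x' m' ->
  frac (f ^+ n *: x + f ^+ m *: y) (m + n)
  = frac (f ^+ n *: x' + f ^+ m' *: y) (m' + n).
Proof.
move=> /frac_eq[a e]; apply/frac_eq; exists a.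
rewrite !scalerDr !scalerA -!exprD; congr (_ + f ^+ _ *: _); last by lia.
have -> : (a + (m' + n) + n = n + n + (a + m'))%N by lia.
have -> : (a + (m + n) + n = n + n + (a + m))%N by lia.
by rewrite ![f ^+ (n + n + _)]exprD -!scalerA e.
Qed.

Lemma ladd_frac x m y n :
  ladd (frac x m) (frac y n) = frac (f ^+ n *: x + f ^+ m *: y) (m + n).
Proof.
rewrite /ladd (ladd_wdl _ _ (frac_repr (frac x m))) addrC addnC.
by rewrite (ladd_wdl _ _ (frac_repr (frac y n))) addrC addnC.
Qed.

Lemma lopp_frac x m : lopp (frac x m) = frac (- x) m.
Proof.
by apply/frac_eq; case: (frac_reprP x m) => a e; exists a; rewrite !scalerN e.
Qed.

Lemma lscale_frac a x m : lscale a (frac x m) = frac (a *: x) m.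
Proof.
apply/frac_eq; case: (frac_reprP x m) => b e; exists b.
by rewrite !scalerA ![_ * a]mulrC -!scalerA e.
Qed.

Lemma frac_sum x y m : frac (f ^+ m *: x + f ^+ m *: y) (m + m) = frac (x + y) m.
Proof.
apply/frac_eq; exists 0%N; rewrite -scalerDr scalerA -exprD.
by congr (f ^+ _ *: _); lia.
Qed.

Fact laddA : associative ladd.
Proof.
move=> u v w; rewrite -[u]frac_repr -[v]frac_repr -[w]frac_repr !ladd_frac addnA.
congr frac; rewrite !scalerDr !scalerA -!exprD addrA.
by congr (_ + _ + _); congr (f ^+ _ *: _); lia.
Qed.
Fact laddC : commutative ladd.
Proof. by move=> u v; rewrite /ladd addrC addnC. Qed.
Fact ladd0 : left_id (frac 0 0) ladd.
Proof.
by move=> u; rewrite -[u]frac_repr ladd_frac scaler0 add0r expr0 scale1r.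
Qed.
Fact laddN : left_inverse (frac 0 0) lopp ladd.
Proof.
move=> u; rewrite -[u]frac_repr lopp_frac ladd_frac frac_sum addNr.
by apply/frac_eq; exists 0%N; rewrite !scaler0.
Qed.

HB.instance Definition _ := GRing.isZmodule.Build loc laddA laddC ladd0 laddN.

Fact lscaleA a b u : lscale a (lscale b u) = lscale (a * b) u.
Proof. by rewrite -[u]frac_repr !lscale_frac scalerA. Qed.
Fact lscale1 : left_id 1 lscale.
Proof. by move=> u; rewrite -[u]frac_repr lscale_frac scale1r. Qed.
Fact lscaleDr : right_distributive lscale +%R.
Proof.
move=> a u v; rewrite -[u]frac_repr -[v]frac_repr; rewrite /GRing.add /=.
rewrite ladd_frac !lscale_frac ladd_frac scalerDr !scalerA.
by rewrite ![a * _]mulrC.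
Qed.
Fact lscaleDl u : {morph lscale^~ u : a b / a + b}.
Proof.
move=> a b; rewrite -[u]frac_repr [in RHS]/GRing.add /= !lscale_frac.
by rewrite ladd_frac frac_sum scalerDl.
Qed.

HB.instance Definition _ := GRing.Zmodule_isLmodule.Build R loc
  lscaleA lscale1 lscaleDr lscaleDl.

End Localization.

(* The localization map V_f -> V_f' when f' = f * h; see loc_mapE. Taking f' as
   an argument avoids casts in the Cech differential. *)
Definition loc_map (R : comNzRingType) (V : lmodType R) (f f' h : R)
    (u : loc V f) : loc V f' :=
  frac f' (h ^+ expon u *: numer u) (expon u).

Lemma loc_mapE (R : comNzRingType) (V : lmodType R) (f f' h : R) x m :
  f' = f * h ->
  @loc_map R V f f' h (frac f x m) = frac f' (h ^+ m *: x) m.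
Proof.
move=> ->; rewrite /loc_map; case: (frac_reprP f x m) => a.
move: (numer _) (expon _) => x' m' e; apply/frac_eq; exists a.
have w p q (y : V) : (f * h) ^+ (a + p) *: (h ^+ q *: y)
    = h ^+ (a + p + q) *: (f ^+ (a + p) *: y).
  by rewrite exprMn !scalerA -mulrA -exprD mulrC.
by rewrite !w e; congr (h ^+ _ *: _); lia.
Qed.

Definition vars k (n : 'I_k -> nat) : finType := {i : 'I_k & 'I_(n i)}.

Notation polyring S n := {mpoly S[#|{: vars n}|]}.

Section Graded.
Context (S : comNzRingType) (k : nat) (n : 'I_k -> nat).
Local Notation R := (polyring S n).
Local Notation Zk := 'rV[int]_k.

Definition e_ (i : 'I_k) : Zk := delta_mx 0 i.

Definition X_ (i : 'I_k) (j : 'I_(n i)) : R :=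
  'X_(enum_rank (Tagged (fun i => 'I_(n i)) j : vars n)).

Definition zdeg (m : 'X_{1..#|{: vars n}|}) : Zk :=
  \sum_(v : vars n) e_ (tag v) *+ m (enum_rank v).

Definition polycomp (alpha : Zk) : set R :=
  [set f | forall m, m \in msupp f -> zdeg m = alpha].

Definition homogeneous (f : R) : Prop := exists alpha, polycomp alpha f.

(* a module together with a family of subsets indexed by Z^k *)
Record pregraded := Pregraded {
  carrier :> lmodType R;
  gcomp : Zk -> set carrier }.
Arguments gcomp : clear implicits.

(* that family makes the module a Z^k-graded R-module *)
Record is_graded (M : pregraded) : Prop := IsGraded {
  gcomp0 : forall gamma, gcomp M gamma 0;
  gcompB : forall gamma x y,
    gcomp M gamma x -> gcomp M gamma y -> gcomp M gamma (x - y);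
  gcompZ : forall alpha gamma a x,
    polycomp alpha a -> gcomp M gamma x -> gcomp M (alpha + gamma) (a *: x);
  gcomp_sum : forall x, exists (s : seq Zk) (c : Zk -> M),
    (forall gamma, gcomp M gamma (c gamma)) /\ x = \sum_(gamma <- s) c gamma;
  gcomp_direct : forall (s : seq Zk) (c : Zk -> M), uniq s ->
    (forall gamma, gcomp M gamma (c gamma)) -> \sum_(gamma <- s) c gamma = 0 ->
    forall gamma, gamma \in s -> c gamma = 0 }.

Record gradedmod := GradedMod {
  gmod :> pregraded;
  gmodP : is_graded gmod }.

Definition Supp (N : pregraded) : set Zk :=
  [set gamma | exists2 x, gcomp N gamma x & x <> 0].

Definition gsub (V : pregraded) (A : set V) : pregraded :=
  @Pregraded (submodule A) (fun gamma x => gcomp V gamma (submodule_val x)).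

Definition gquot (V : pregraded) (A : set V) : pregraded :=
  @Pregraded (modquot A) (fun gamma => qpi A @` gcomp V gamma).

(* The subquotient Z / Bd. It is only used with submodules Bd `<=` Z of V, for
   which the generated submodules in gsub and gquot are Z and Bd themselves. *)
Definition homology (V : pregraded) (Z Bd : set V) : pregraded :=
  @gquot (gsub Z) [set z | Bd (submodule_val z)].

Definition degree0 (M N : pregraded) (f : M -> N) : Prop :=
  forall gamma x, gcomp M gamma x -> gcomp N gamma (f x).

Definition graded_free (F : pregraded) : Prop :=
  exists (I : choiceType) (b : I -> F) (d : I -> Zk),
  [/\ forall i, gcomp F (d i) (b i),
      forall x, exists (s : seq I) (c : I -> R), x = \sum_(i <- s) c i *: b i
    & forall (s : seq I) (c : I -> R), uniq s ->
        \sum_(i <- s) c i *: b i = 0 -> forall i, i \in s -> c i = 0].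

Record gfree_resolution (M : pregraded) := GfreeResolution {
  res_mod :> nat -> gradedmod;
  res_d : forall j, {linear res_mod j.+1 -> res_mod j};
  res_aug : {linear res_mod 0%N -> M};
  res_free : forall j, graded_free (res_mod j);
  res_d_degree0 : forall j, degree0 (res_d j);
  res_aug_degree0 : degree0 res_aug;
  res_aug_surj : forall x, exists y, res_aug y = x;
  res_exact0 : forall x, res_aug x = 0 <-> exists y, res_d 0%N y = x;
  res_exact : forall j x, res_d j x = 0 <-> exists y, res_d j.+1 y = x }.

Definition gtensor (M N : pregraded) : pregraded :=
  @Pregraded (tensor M N) (fun gamma => [set u | exists2 s : seq (M * N),
    forall q, q \in s -> exists alpha beta,
      [/\ gcomp M alpha q.1, gcomp N beta q.2 & gamma = alpha + beta]
    & u = \sum_(q <- s) tens q.1 q.2]).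

Section Tor.
Context (M N : pregraded) (F : gfree_resolution M).

Definition tor_cycles j : set (gtensor (F j) N) :=
  match j with
  | 0%N => setT
  | j'.+1 => [set u : gtensor (F j'.+1) N | tensor_map (res_d F j') u = 0]
  end.

Definition tor_boundaries j : set (gtensor (F j) N) :=
  range (tensor_map (res_d F j) : gtensor (F j.+1) N -> gtensor (F j) N).

(* H_j of F (x) N, i.e. Tor_j^R(M, N) *)
Definition Tor j : pregraded := homology (@tor_cycles j) (@tor_boundaries j).

End Tor.

Section Cech.
Context (r : nat) (g : 'I_r -> R) (M : pregraded).

Definition gprod (T : {set 'I_r}) : R := \prod_(t in T) g t.

Definition gloc (f : R) : pregraded :=
  (* the degree of x / f ^+ m is deg x - m deg f *)
  @Pregraded (loc M f) (fun gamma => [set u | exists alpha m x,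
    [/\ polycomp alpha f, gcomp M (gamma + alpha *+ m) x & u = frac f x m]]).

Definition face p : finType := {T : {set 'I_r} | #|T| == p}.

Definition cech p : pregraded :=
  @Pregraded (dprod (fun T : face p => gloc (gprod (val T))))
    (fun gamma => [set c | forall T, gcomp (gloc (gprod (val T))) gamma (c T)]).

(* T ranges over the faces with p+1 elements, so the partial inverse insub is
   defined on every T :\ t with t in T *)
Definition cech_d p (c : cech p) : cech p.+1 :=
  dprod_of (fun T : face p.+1 => \sum_(t in val T)
    if insub (val T :\ t) is Some T' then
      (-1) ^+ #|[pred s in val T | (s < t)%N]|
        *: loc_map (gprod (val T)) (g t) (c T')
    else 0).

Definition cech_cocycles p : set (cech p) := [set c | cech_d c = 0].

Definition cech_coboundaries p : set (cech p) :=
  match p with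
  | 0%N => [set 0]
  | p'.+1 => range (@cech_d p')
  end.

(* H^p_I(M), for I the ideal generated by the finite family g *)
Definition local_cohomology p : pregraded :=
  homology (@cech_cocycles p) (@cech_coboundaries p).

Definition CC : set Zk := \bigcup_p Supp (local_cohomology p).

End Cech.

Definition ideal (A : set R) : set R := @span R R^o A.

Definition B_ (i : 'I_k) : set R := ideal (range (@X_ i)).

(* B_(iota 0) + ... + B_(iota (p - 1)) *)
Definition sumB p (iota : 'I_p -> 'I_k) : set R :=
  [set f | exists2 h : 'I_p -> R, forall l, B_ (iota l) (h l) & f = \sum_l h l].

Definition gring : pregraded := @Pregraded R^o polycomp.

Definition ring_mod (I : set R) : pregraded := @gquot gring I.

Definition a_ p (iota : 'I_p -> 'I_k) : Zk := - \sum_l e_ (iota l) *+ n (iota l).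

Definition That (M : pregraded) (F : gfree_resolution M) p
    (iota : 'I_p -> 'I_k) : set Zk :=
  [set a_ iota + gamma | gamma in
     \bigcup_j Supp (Tor (ring_mod (sumB iota)) F j)].

End Graded.

Section DegreeSets.
Context (k : nat).
Implicit Types E F : set 'rV[int]_k.

Definition subset_sub E F : set 'rV[int]_k :=
  [set x | exists2 e, E e & exists2 f, F f & x = e - f].

Definition orthant : set 'rV[int]_k := [set x | forall i, 0 <= x 0 i].

Definition star E : set 'rV[int]_k := subset_sub E orthant.

(* the N-linear combinations of e_(iota 0), ..., e_(iota (p - 1)) *)
Definition cone p (iota : 'I_p -> 'I_k) : set 'rV[int]_k :=
  [set x | exists c : 'I_p -> nat, x = \sum_l e_ (iota l) *+ c l].

End DegreeSets.

(* Main.v *)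
From HB Require Import structures.
Require Import Defs.
From mathcomp Require Import all_boot all_order all_algebra.
From mathcomp Require Import boolp classical_sets.
From mathcomp Require Import freeg mpoly.

(** Both sides only depend on which degrees carry some homology, so complexes
    are compared through acyclicity in given degrees. For a variable
    [x] of degree [e], the cone of multiplication by [x] on a complex [V] is
    acyclic in the degrees of a set stable under [+ e] if [V] is, and conversely
    if the homology of [V] is [x]-torsion. Iterating over the variables [X] of
    the blocks gives the Koszul complex [K(X; V)]. The Cech complex [C] of [M] has
    torsion homology, hence its vanishing on a translate of the cone is that of
    [K(X; C)]. All terms of [C] except [M] itself are localizations at elements of
    the ideal; those are killed by [K(X; -)], on whose homology the ideal is
    torsion, so [K(X; C)] is equivalent to [K(X; M)], and then to [K(X; F)] for the
    free resolution [F] of [M]. As the variables form a regular sequence on free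
    modules, [K(X; F)] is equivalent to [F / (X) F], up to the shift by the sum of
    the degrees of the variables; this computes Tor. *)

Set Implicit Arguments.
Unset Strict Implicit.
Unset Printing Implicit Defensive.

Import GRing.Theory Num.Theory.
Local Open Scope classical_set_scope.
Local Open Scope ring_scope.
Local Notation span := Defs.span.
Local Notation frac := Defs.frac.

(** * Equations in abelian groups, by reflection *)

(** A point [y] lies in [E - C] exactly when [E] meets the translate [y + C], so the claim is that,
    for every [y], Tor and local cohomology vanish together on [y + C]. Such a statement does not
    see the homological index. Hence a complex is a single module with an endomorphism, gathering
    all faces or all steps of the resolution; and instead of a long exact sequence only two out of
    three is used, for an acyclic kernel. As [S] is arbitrary and [M] need not be finitely
    generated, torsion is a condition on each class, with an exponent depending on the class, and
    descents are inductions on this exponent. The translates appear because a cone mixes the degrees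
    [a] and [e + a], and because a class in degree [a] is recovered from its multiples in higher
    degrees. Every other comparison holds degree by degree. *)

Inductive zterm := ZVar of nat | ZAdd of zterm & zterm | ZOpp of zterm | ZZero.

Fixpoint zeval (V : zmodType) (env : seq V) (t : zterm) : V :=
  match t with
  | ZVar i => env`_i
  | ZAdd t1 t2 => zeval env t1 + zeval env t2
  | ZOpp t => - zeval env t
  | ZZero => 0
  end.

Fixpoint zcoef (t : zterm) (i : nat) : int :=
  match t with
  | ZVar j => (i == j)%:R
  | ZAdd t1 t2 => zcoef t1 i + zcoef t2 i
  | ZOpp t => - zcoef t i
  | ZZero => 0
  end.

Lemma zevalE (V : zmodType) (env : seq V) (t : zterm) :
  zeval env t = \sum_(i < size env) env`_i *~ zcoef t i.
Proof.
elim: t => [j|t1 IH1 t2 IH2|t IH|] /=.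
- have [ltj|gej] := ltnP j (size env).
    rewrite (bigD1 (Ordinal ltj)) //= eqxx big1 ?addr0 // => i ne.
    by rewrite -val_eqE /= in ne; rewrite (negbTE ne).
  rewrite nth_default // big1 // => i _.
  by rewrite (_ : _ == _ = false) //; apply/eqP => e; rewrite -e leqNgt ltn_ord in gej.
- by rewrite IH1 IH2 -big_split; apply: eq_bigr => i _; rewrite mulrzDr.
- by rewrite IH -sumrN; apply: eq_bigr => i _; rewrite mulrNz.
- by rewrite big1 // => i _; rewrite mulr0z.
Qed.

Lemma zeval_eq (V : zmodType) (env : seq V) (t1 t2 : zterm) :
  all (fun i => zcoef t1 i == zcoef t2 i) (seq.iota 0 (size env)) ->
  zeval env t1 = zeval env t2.
Proof.
move/allP=> h; rewrite !zevalE; apply: eq_bigr => i _; congr (_ *~ _); apply/eqP.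
by apply: h; rewrite mem_iota /= ltn_ord.
Qed.

(* [unify] runs while the term is being built, so that its failure selects the
   next branch. *)
Ltac zatom x env :=
  lazymatch env with
  | nil => constr:((0%N, cons x nil))
  | cons ?y ?env' =>
    match constr:(Set) with
    | _ => let _ := match constr:(Set) with _ => unify x y end in
           constr:((0%N, env))
    | _ => lazymatch zatom x env' with
           | (?i, ?env'') => constr:((i.+1, cons y env''))
           end
    end
  end.

Ltac zquote t env :=
  lazymatch t with
  | (?a + ?b)%R =>
    lazymatch zquote a env with
    | (?ta, ?env1) => lazymatch zquote b env1 with
                      | (?tb, ?env2) => constr:((ZAdd ta tb, env2))
                      end
    end
  | (- ?a)%R =>
    lazymatch zquote a env with (?ta, ?env1) => constr:((ZOpp ta, env1)) end
  | 0%R => constr:((ZZero, env))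
  | _ => lazymatch zatom t env with (?i, ?env1) => constr:((ZVar i, env1)) end
  end.

Ltac zmod_eq :=
  lazymatch goal with
  | |- @eq ?T ?a ?b =>
    lazymatch zquote a (@nil T) with
    | (?ta, ?env1) => lazymatch zquote b env1 with
      | (?tb, ?env2) =>
        exact: (@zeval_eq _ (env2 : seq _) ta tb (erefl true))
      end
    end
  end.

(** * Relative differential graded modules *)

(* An endomorphism [dif] of a module, and families [G], [Z] of subsets indexed
   by the degrees: the object of interest in degree [a] is [G a / Z a]. Keeping
   [Z] instead of dividing by it makes subobjects and quotients live on the same
   carrier. *)
Record reldiff (R : nzRingType) (D : Type) := Reldiff {
  rcar :> lmodType R;
  dif : rcar -> rcar;
  gpart : D -> set rcar;
  zpart : D -> set rcar }.

Arguments dif {R D}.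
Arguments gpart {R D}.
Arguments zpart {R D}.

Record gradation (R : comNzRingType) (D : zmodType) (hom : D -> set R) : Prop :=
  Gradation {
  hom0 : forall a, hom a 0;
  hom1 : hom 0 1;
  homD : forall a x y, hom a x -> hom a y -> hom a (x + y);
  homN : forall a x, hom a x -> hom a (- x);
  homM : forall a b x y, hom a x -> hom b y -> hom (a + b) (x * y);
  hom_uniq : forall a b x, hom a x -> hom b x -> x <> 0 -> a = b }.

Section Reldiff.
Context (R : comNzRingType) (D : zmodType) (hom : D -> set R).
Hypothesis gr : gradation hom.
Implicit Types (U V W : reldiff R D) (a b c : D).

Lemma homX a x m : hom a x -> hom (a *+ m) (x ^+ m).
Proof.
move=> h; elim: m => [|m IH]; first by rewrite mulr0n expr0; exact: (hom1 gr).
by rewrite mulrS exprS; exact: (homM gr).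
Qed.

Record reldiffP V : Prop := ReldiffP {
  difP : linear (dif V);
  gpart0 : forall a, gpart V a 0;
  gpartB : forall a u v, gpart V a u -> gpart V a v -> gpart V a (u - v);
  gpartZ : forall a b x u, hom a x -> gpart V b u -> gpart V (a + b) (x *: u);
  gpart_dif : forall a u, gpart V a u -> gpart V a (dif V u);
  zpart_sub : forall a u, zpart V a u -> gpart V a u;
  zpart0 : forall a, zpart V a 0;
  zpartB : forall a u v, zpart V a u -> zpart V a v -> zpart V a (u - v);
  zpartZ : forall a b x u, hom a x -> zpart V b u -> zpart V (a + b) (x *: u);
  zpart_dif : forall a u, zpart V a u -> zpart V a (dif V u);
  dif2 : forall a u, gpart V a u -> zpart V a (dif V (dif V u)) }.

Section Theory.
Variables (V : reldiff R D) (okV : reldiffP V).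
Local Notation d := (dif V).
Local Notation G := (gpart V).
Local Notation Z := (zpart V).

Lemma difD u v : d (u + v) = d u + d v.
Proof. by have := difP okV 1 u v; rewrite !scale1r. Qed.
Lemma dif0 : d 0 = 0.
Proof. by apply: (@addrI _ (d 0)); rewrite -difD !addr0. Qed.
Lemma difZ x u : d (x *: u) = x *: d u.
Proof. by have := difP okV x u 0; rewrite dif0 !addr0. Qed.
Lemma difN u : d (- u) = - d u.
Proof. by rewrite -scaleN1r difZ scaleN1r. Qed.

Lemma gpartN a u : G a u -> G a (- u).
Proof. by rewrite -sub0r; exact/(gpartB okV)/(gpart0 okV). Qed.
Lemma gpartD a u v : G a u -> G a v -> G a (u + v).
Proof. by move=> gu gv; rewrite -[v]opprK; exact/(gpartB okV)/gpartN. Qed.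
Lemma zpartN a u : Z a u -> Z a (- u).
Proof. by rewrite -sub0r; exact/(zpartB okV)/(zpart0 okV). Qed.
Lemma zpartD a u v : Z a u -> Z a v -> Z a (u + v).
Proof. by move=> gu gv; rewrite -[v]opprK; exact/(zpartB okV)/zpartN. Qed.

End Theory.

(** * Acyclicity, torsion and bijective multiplication *)

Definition acyclic V a : Prop := forall u, gpart V a u -> zpart V a (dif V u) ->
  exists2 v, gpart V a v & zpart V a (u - dif V v).

Definition torsion V f e : Prop :=
  forall a z, gpart V a z -> zpart V a (dif V z) -> exists N w,
  gpart V (e *+ N + a) w /\ zpart V (e *+ N + a) (f ^+ N *: z - dif V w).

Definition bijmul V f e : Prop :=
  (forall a u, gpart V a u -> zpart V (e + a) (f *: u) -> zpart V a u) /\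
  (forall a u, gpart V (e + a) u ->
     exists2 v, gpart V a v & zpart V (e + a) (u - f *: v)).

(** Descent on the exponent: if [f ^+ N.+1 *: u] is the boundary of [w], dividing [w] by [f] gives
    [v] with [f *: (f ^+ N *: u - dif V v)] zero modulo [Z], and injectivity removes [f]. *)
Lemma torsion_bijmul_acyclic V f e : reldiffP V -> hom e f ->
  torsion V f e -> bijmul V f e -> forall a, acyclic V a.
Proof.
move=> ok hf tf [inj surj] a u gu du.
have [N [w [gw]]] := tf a u gu du.
elim: N w gw => [|N IH] w gw.
  by rewrite mulr0n add0r expr0 scale1r in gw * => h; exists w.
rewrite mulrS -addrA in gw * => h.
have [v gv zv] := surj _ _ gw.
apply: (IH v) => //; apply: inj.
  by apply: (gpartB ok); [apply/(gpartZ ok) => //; exact: homX|apply: (gpart_dif ok)].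
rewrite (_ : f *: _ = (f ^+ N.+1 *: u - dif V w) + dif V (w - f *: v)).
  by apply: (zpartD ok) => //; exact: zpart_dif.
rewrite scalerBr scalerA -exprS (difD ok) (difN ok) (difZ ok); zmod_eq.
Qed.

Section Sum.
Variables (V : reldiff R D) (okV : reldiffP V) (a : D) (z : V).
Hypothesis gz : gpart V a z.

Definition killer e f := exists2 w,
  gpart V (e + a) w & zpart V (e + a) (f *: z - dif V w).

Lemma killer0 e : killer e 0.
Proof.
exists 0; rewrite ?(dif0 okV) ?scale0r ?subr0; [exact: gpart0|exact: zpart0].
Qed.

Lemma killerD e f g : killer e f -> killer e g -> killer e (f + g).
Proof.
move=> [w gw zw] [w' gw' zw']; exists (w + w'); first exact: gpartD.
rewrite (_ : _ - _ = (f *: z - dif V w) + (g *: z - dif V w')); first exact: zpartD.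
rewrite scalerDl (difD okV); zmod_eq.
Qed.

Lemma killerMn e f m : killer e f -> killer e (f *+ m).
Proof.
move=> h; elim: m => [|m IH]; rewrite ?mulr0n ?mulrS; [exact: killer0|exact: killerD].
Qed.

Lemma killerM c e q f : hom c q -> killer e f -> killer (c + e) (q * f).
Proof.
move=> hq [w gw zw]; exists (q *: w); first by rewrite -addrA; exact: gpartZ.
by rewrite -scalerA (difZ okV) -scalerBr -addrA; exact: zpartZ.
Qed.

(** In every monomial of the binomial expansion, either [f] has exponent at least [N] or [g] has
    exponent at least [N']. *)
Lemma killer_addX e f g N N' : hom e f -> hom e g ->
  killer (e *+ N) (f ^+ N) -> killer (e *+ N') (g ^+ N') ->
  killer (e *+ (N + N')) ((f + g) ^+ (N + N')).
Proof.
move=> hf hg kf kg; rewrite exprDn.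
elim/big_ind: _ => [|x y|i _]; [exact: killer0|exact: killerD|].
apply: killerMn; have := ltn_ord i; move: (nat_of_ord i) => {}i; rewrite ltnS => lei.
have kc j l y z' : (j + l = N + N')%N -> hom (e *+ j) y ->
    killer (e *+ l) z' -> killer (e *+ (N + N')) (y * z').
  by move=> <- hy; rewrite mulrnDr; exact: killerM.
have [le|lt] := leqP N' i.
  rewrite -(subnK le) exprD mulrA; apply: (kc (N + N' - i + (i - N'))%N N') => //.
    by rewrite -addnA subnK // subnK.
  by rewrite subnK // mulrnDr; apply: (homM gr); exact: homX.
have e1 : (N + N' - i = N' - i + N)%N by rewrite addnC addnBAC // ltnW.
rewrite e1 exprD mulrAC; apply: (kc (N' - i + i)%N N) => //.
  by rewrite subnK 1?addnC // ltnW.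
by rewrite mulrnDr; apply: (homM gr); exact: homX.
Qed.

End Sum.

(** For a fixed class, the elements with a power killing it form the radical of its annihilator; the
    predicate [P] keeps track of the degree [b], which the binomial argument requires. *)
Lemma torsion_sum V (I : finType) (q f : I -> R) (e : I -> D) b :
  reldiffP V -> (forall i, hom (b - e i) (q i)) -> (forall i, hom (e i) (f i)) ->
  (forall i, torsion V (f i) (e i)) -> torsion V (\sum_i q i * f i) b.
Proof.
move=> ok hq hf tf a z gz dz.
pose P g := hom b g /\ exists N, killer a z (b *+ N) (g ^+ N).
suff [_ [N [w gw zw]]] : P (\sum_i q i * f i) by exists N, w.
elim/big_ind: _ => [|x y [hx [N kx]] [hy [N' ky]]|i _].
- by split; [exact: (hom0 gr)|exists 1%N; rewrite expr1; exact: killer0].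
- by split; [exact: (homD gr)|exists (N + N')%N; exact: killer_addX].
- have [N [w [gw zw]]] := tf i a z gz dz.
  have h0 : hom b (q i * f i) by rewrite -[b](subrK (e i)); exact: (homM gr).
  split=> //; exists N; rewrite exprMn -[b](subrK (e i)) mulrnDl.
  by apply: killerM => //; [exact: homX|exists w].
Qed.

(** * The cone of multiplication by a ring element *)

(** The second copy of [V] is shifted by [e], so that [x] maps degree [a] to degree [e + a]; the
    sign makes the square of the differential vanish modulo [Z]. *)
Definition mulcone (x : R) (e : D) V : reldiff R D :=
  @Reldiff R D (V * V)%type (fun p => (- dif V p.1, x *: p.1 + dif V p.2))
    (fun a => [set p | gpart V a p.1 /\ gpart V (e + a) p.2])
    (fun a => [set p | zpart V a p.1 /\ zpart V (e + a) p.2]).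

Section MulCone.
Variables (x : R) (e : D) (V : reldiff R D).
Hypotheses (hx : hom e x) (okV : reldiffP V).

Lemma mulconeP : reldiffP (mulcone x e V).
Proof.
split=> /=.
- move=> c u v; congr pair => /=; rewrite !(difD okV) !(difZ okV).
    by rewrite opprD scalerN.
  rewrite !scalerDr !scalerA [x * c]mulrC; zmod_eq.
- by move=> a; split; exact: (gpart0 okV).
- by move=> a u v [? ?] [? ?]; split; exact: (gpartB okV).
- move=> a b y u hy [? ?]; split; first exact: (gpartZ okV).
  by rewrite addrCA; exact: (gpartZ okV).
- move=> a u [g1 g2]; split; first by apply: (gpartN okV); exact: gpart_dif.
  by apply: (gpartD okV); [exact: gpartZ|exact: gpart_dif].
- by move=> a u [? ?]; split; exact: zpart_sub.
- by move=> a; split; exact: (zpart0 okV).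
- by move=> a u v [? ?] [? ?]; split; exact: (zpartB okV).
- move=> a b y u hy [? ?]; split; first exact: (zpartZ okV).
  by rewrite addrCA; exact: (zpartZ okV).
- move=> a u [g1 g2]; split; first by apply: (zpartN okV); exact: zpart_dif.
  by apply: (zpartD okV); [exact: zpartZ|exact: zpart_dif].
- move=> a u [g1 g2]; split; first by rewrite (difN okV) opprK; exact: dif2.
  by rewrite (difD okV) (difZ okV) scalerN addKr; exact: dif2.
Qed.

(** The cone is an extension of [V] by a shifted [V]: a primitive [v1] of the first coordinate, up
    to sign, is found first, and the second coordinate is corrected by [x *: v1]. *)
Lemma mulcone_acyclic a : acyclic V a -> acyclic V (e + a) -> acyclic (mulcone x e V) a.
Proof.
move=> ac1 ac2 [u1 u2] /= [g1 g2] [z1 z2].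
have {}z1 : zpart V a (dif V u1) by rewrite -[dif _ _]opprK; exact: zpartN.
have [v1 gv1 zv1] := ac1 _ g1 z1.
have [||v2 gv2 zv2] := ac2 (u2 + x *: v1).
- by apply: (gpartD okV) => //; exact: gpartZ.
- rewrite (_ : dif V _ = (x *: u1 + dif V u2) - x *: (u1 - dif V v1)).
    by apply: (zpartB okV) => //; exact: zpartZ.
  rewrite (difD okV) (difZ okV) scalerBr; zmod_eq.
exists (- v1, v2) => /=; first by split=> //; exact: gpartN.
rewrite (difN okV) opprK; split => //=.
by rewrite (_ : _ - _ = u2 + x *: v1 - dif V v2) // scalerN; zmod_eq.
Qed.

(** A relation [x ^+ N.+1 *: u = dif V w] modulo [Z] makes [(x ^+ N *: u, - w)] a cycle of the cone.
    Its primitive lowers the exponent; stability of [Y] keeps the degree [e *+ N + a] inside [Y]. *)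
Lemma acyclic_of_mulcone (Y : D -> Prop) : (forall a, Y a -> Y (e + a)) ->
  torsion V x e -> (forall a, Y a -> acyclic (mulcone x e V) a) ->
  forall a, Y a -> acyclic V a.
Proof.
move=> Ye tx acc a Ya u gu du.
have [N [w [gw]]] := tx a u gu du.
elim: N w gw => [|N IH] w gw.
  by rewrite mulr0n add0r expr0 scale1r in gw * => h; exists w.
move=> h; have YN : Y (e *+ N + a).
  by elim: (N) => [|m IHm]; rewrite ?mulr0n ?add0r // mulrS -addrA; exact: Ye.
have [||[v1 v2] [gv1 gv2] [zv1 zv2]] := acc _ YN (x ^+ N *: u, - w).
- split=> /=; first by apply: (gpartZ okV) => //; exact: homX.
  by rewrite addrA -mulrS; exact: (gpartN okV).
- split=> /=.
    by apply: (zpartN okV); rewrite (difZ okV); apply: (zpartZ okV) => //; exact: homX.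
  by rewrite scalerA -exprS addrA -mulrS (difN okV).
apply: (IH (- v1)); first exact: (gpartN okV).
by rewrite (difN okV).
Qed.

(** A power of [f] makes the first coordinate the boundary of some [v]; then [f ^+ N *: u2 + x *: v]
    is a cycle of [V], killed by a further power. The exponents add. *)
Lemma mulcone_torsion f b : hom b f -> torsion V f b -> torsion (mulcone x e V) f b.
Proof.
move=> hf tf a [u1 u2] /= [g1 g2] [z1 z2].
have {}z1 : zpart V a (dif V u1) by rewrite -[dif _ _]opprK; exact: zpartN.
have [N [v [gv zv]]] := tf _ _ g1 z1.
have [||N' [w [gw zw]]] := tf (e + (b *+ N + a)) (f ^+ N *: u2 + x *: v).
- apply: (gpartD okV); last exact: gpartZ.
  by rewrite addrCA; apply: (gpartZ okV) => //; exact: homX.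
- rewrite (_ : dif V _ = f ^+ N *: (x *: u1 + dif V u2)
      - x *: (f ^+ N *: u1 - dif V v)).
    apply: (zpartB okV); last exact: zpartZ.
    by rewrite addrCA; apply: (zpartZ okV) => //; exact: homX.
  rewrite (difD okV) !(difZ okV) scalerBr scalerDr !scalerA [x * _]mulrC; zmod_eq.
exists (N' + N)%N, (- (f ^+ N' *: v), w).
have eN c : b *+ (N' + N) + c = b *+ N' + (b *+ N + c) by rewrite mulrnDr addrA.
split=> /=; split=> /=.
- by apply: (gpartN okV); rewrite eN; apply: (gpartZ okV) => //; exact: homX.
- by move: gw; rewrite eN addrCA.
- rewrite eN exprD -scalerA (difN okV) opprK (difZ okV) -scalerBr.
  by apply: (zpartZ okV) => //; exact: homX.
- have -> : e + (b *+ (N' + N) + a) = b *+ N' + (e + (b *+ N + a)) by rewrite eN addrCA.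
  rewrite (_ : _ - _ = f ^+ N' *: (f ^+ N *: u2 + x *: v) - dif V w) //.
  rewrite scalerDr scalerN !scalerA -exprD [x * _]mulrC; zmod_eq.
Qed.

(* [s (u, v) = (v, 0)] is a homotopy from multiplication by [x] to [0] *)
Lemma mulcone_torsion_self : torsion (mulcone x e V) x e.
Proof.
move=> a [u1 u2] /= [g1 g2] [z1 z2]; exists 1%N, (u2, 0).
rewrite mulr1n expr1 /=; split; split=> //=; first exact: gpart0.
  rewrite (_ : _ - _ = x *: u1 + dif V u2) //=.
  by rewrite opprK.
rewrite (_ : _ - _ = 0) ?(dif0 okV) ?addr0 ?subrr //; exact: zpart0.
Qed.

Lemma mulcone_bijmul f b : hom b f -> bijmul V f b -> bijmul (mulcone x e V) f b.
Proof.
move=> hf [inj surj]; split=> a [u1 u2] /= [g1 g2].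
  by case=> z1 z2; split; apply: inj => //=; rewrite addrCA.
have [v1 gv1 zv1] := surj _ _ g1; rewrite addrCA in g2.
have [v2 gv2 zv2] := surj _ _ g2.
by exists (v1, v2); split=> //=; rewrite addrCA.
Qed.

End MulCone.

(** * Short exact sequences and two out of three *)

(** Exactness of the quotients [G / Z] in each degree. The maps commute with the differentials only
    modulo [Z]: this admits the second projection of a cone onto a quotient where [x] is zero, and
    an augmentation that is correct on the empty face alone. *)
Definition short_exact U V W : Prop := exists (i : U -> V) (p : V -> W),
  [/\ linear i, linear p,
      forall a u, gpart U a u -> gpart V a (i u)
        /\ zpart V a (i (dif U u) - dif V (i u)),
      forall a v, gpart V a v -> gpart W a (p v)
        /\ zpart W a (p (dif V v) - dif W (p v)) &
  [/\ forall a u, gpart U a u -> (zpart V a (i u) <-> zpart U a u),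
      forall a v, zpart V a v -> zpart W a (p v),
      forall a u, gpart U a u -> zpart W a (p (i u)),
      forall a v, gpart V a v -> zpart W a (p v) ->
        exists2 u, gpart U a u & zpart V a (v - i u)
    & forall a w, gpart W a w -> exists2 v, gpart V a v & zpart W a (w - p v)]].

Lemma mulcone_short_exact x e U V W : hom e x -> reldiffP V -> reldiffP W ->
  short_exact U V W -> short_exact (mulcone x e U) (mulcone x e V) (mulcone x e W).
Proof.
move=> hx okV okW [i [p [li lp gi gp [zi zp zpi ex surj]]]].
have iD u v : i (u + v) = i u + i v by have := li 1 u v; rewrite !scale1r.
have i0 : i 0 = 0 by apply: (@addrI _ (i 0)); rewrite -iD !addr0.
have iZ y u : i (y *: u) = y *: i u by have := li y u 0; rewrite i0 !addr0.
have pD u v : p (u + v) = p u + p v by have := lp 1 u v; rewrite !scale1r.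
have p0 : p 0 = 0 by apply: (@addrI _ (p 0)); rewrite -pD !addr0.
have pZ y u : p (y *: u) = y *: p u by have := lp y u 0; rewrite p0 !addr0.
exists (fun u => (i u.1, i u.2)), (fun u => (p u.1, p u.2)); split; last split.
- by move=> y u v; congr pair => /=; rewrite li.
- by move=> y u v; congr pair => /=; rewrite lp.
- move=> a u [/gi[g1 z1] /gi[g2 z2]]; split; split=> //=.
    rewrite -scaleN1r iZ scaleN1r (_ : _ - _ = - (i (dif U u.1) - dif V (i u.1))).
      exact: zpartN.
    zmod_eq.
  by rewrite iD iZ (_ : _ - _ = i (dif U u.2) - dif V (i u.2)) //; zmod_eq.
- move=> a u [/gp[g1 z1] /gp[g2 z2]]; split; split=> //=.
    rewrite -scaleN1r pZ scaleN1r (_ : _ - _ = - (p (dif V u.1) - dif W (p u.1))).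
      exact: zpartN.
    zmod_eq.
  by rewrite pD pZ (_ : _ - _ = p (dif V u.2) - dif W (p u.2)) //; zmod_eq.
- by move=> a u [g1 g2]; split=> -[z1 z2]; split; apply/zi.
- by move=> a u [z1 z2]; split; exact: zp.
- by move=> a u [z1 z2]; split; exact: zpi.
- move=> a v [g1 g2] [z1 z2].
  have [u1 h1 h2] := ex _ _ g1 z1; have [u2 h3 h4] := ex _ _ g2 z2.
  by exists (u1, u2).
- move=> a v [g1 g2].
  have [u1 h1 h2] := surj _ _ g1; have [u2 h3 h4] := surj _ _ g2.
  by exists (u1, u2).
Qed.

(** The exact triangle of homology with vanishing homology of [U], chased by hand modulo [Z]. *)
Lemma short_exact_acyclic U V W a : reldiffP U -> reldiffP V -> reldiffP W ->
  short_exact U V W -> acyclic U a -> (acyclic V a <-> acyclic W a).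
Proof.
move=> okU okV okW [i [p [li lp gi gp [zi zp zpi ex surj]]]] acU.
have iD u v : i (u + v) = i u + i v by have := li 1 u v; rewrite !scale1r.
have iN u : i (- u) = - i u.
  by apply: (@addrI _ (i u)); rewrite -iD !subrr; apply: (@addrI _ (i 0)); rewrite -iD !addr0.
have pD u v : p (u + v) = p u + p v by have := lp 1 u v; rewrite !scale1r.
have pN u : p (- u) = - p u.
  by apply: (@addrI _ (p u)); rewrite -pD !subrr; apply: (@addrI _ (p 0)); rewrite -pD !addr0.
split=> [acV w gw dw|acW v gv dv].
(* Lift [w] to [v]; its boundary comes from a cycle [u] of [U], whose primitive [u'] turns [v] into
   the cycle [v - i u']. *)
- have [v gv zv] := surj _ _ gw; have [gpv zdpv] := gp _ _ gv.
  have zpdv : zpart W a (p (dif V v)).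
    rewrite (_ : p _ = (p (dif V v) - dif W (p v)) + (dif W w - dif W (w - p v))).
      by apply: (zpartD okW) => //; apply: (zpartB okW) => //; exact: zpart_dif.
    rewrite (difD okW) (difN okW); zmod_eq.
  have [u gu zu] := ex _ _ (gpart_dif okV gv) zpdv; have [giu zdiu] := gi _ _ gu.
  have [||u' gu' zu'] := acU u => //.
    apply/zi; first exact: (gpart_dif okU).
    rewrite (_ : i _ = (i (dif U u) - dif V (i u))
        + (dif V (dif V v) - dif V (dif V v - i u))).
      apply: (zpartD okV) => //; apply: (zpartB okV); first exact: (dif2 okV).
      exact: (zpart_dif okV).
    rewrite (difD okV) (difN okV); zmod_eq.
  have [giu' zdiu'] := gi _ _ gu'.
  have gb : gpart U a (u - dif U u').
    by apply: (gpartB okU) => //; exact: gpart_dif.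
  have [||v' gv' zv'] := acV (v - i u').
  + exact: (gpartB okV).
  + rewrite (_ : dif V _ = (dif V v - i u) + i (u - dif U u')
        + (i (dif U u') - dif V (i u'))).
      by apply: (zpartD okV) => //; apply: (zpartD okV) => //; apply/zi.
    rewrite (difD okV) (difN okV) iD iN; zmod_eq.
  have [gpv' zdpv'] := gp _ _ gv'.
  exists (p v') => //.
  rewrite (_ : _ - _ = (w - p v) + p (v - i u' - dif V v') + p (i u')
     + (p (dif V v') - dif W (p v'))).
    apply: (zpartD okW) => //; apply: (zpartD okW); last exact: zpi.
    by apply: (zpartD okW) => //; exact: zp.
  rewrite !pD !pN; zmod_eq.
(* A primitive [w] of [p v] lifts to [v1]; the difference [v - dif V v1] comes from a cycle of [U],
   whose primitive corrects [v1]. *)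
- have [gpv zdpv] := gp _ _ gv.
  have [||w gw zw] := acW (p v) => //.
    rewrite (_ : dif W _ = p (dif V v) - (p (dif V v) - dif W (p v))).
      by apply: (zpartB okW) => //; exact: zp.
    zmod_eq.
  have [v1 gv1 zv1] := surj _ _ gw; have [gpv1 zdpv1] := gp _ _ gv1.
  have gb : gpart V a (v - dif V v1).
    by apply: (gpartB okV) => //; exact: (gpart_dif okV).
  have [|u gu zu] := ex _ _ gb.
    rewrite (_ : p _ = (p v - dif W w) + dif W (w - p v1)
       - (p (dif V v1) - dif W (p v1))).
      apply: (zpartB okW) => //; apply: (zpartD okW) => //; exact: zpart_dif.
    rewrite pD pN (difD okW) (difN okW); zmod_eq.
  have [giu zdiu] := gi _ _ gu.
  have [||u' gu' zu'] := acU u => //.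
    apply/zi; first exact: (gpart_dif okU).
    rewrite (_ : i _ = (i (dif U u) - dif V (i u)) + (dif V v - dif V (dif V v1))
       - dif V (v - dif V v1 - i u)).
      apply: (zpartB okV); last exact: (zpart_dif okV).
      apply: (zpartD okV) => //; apply: (zpartB okV) => //; exact: (dif2 okV).
    rewrite !(difD okV) !(difN okV); zmod_eq.
  have [giu' zdiu'] := gi _ _ gu'.
  have gc : gpart U a (u - dif U u').
    by apply: (gpartB okU) => //; exact: gpart_dif.
  exists (v1 + i u'); first exact: (gpartD okV).
  rewrite (_ : _ - _ = (v - dif V v1 - i u) + i (u - dif U u')
     + (i (dif U u') - dif V (i u'))).
    by apply: (zpartD okV) => //; apply: (zpartD okV) => //; apply/zi.
  rewrite iD iN (difD okV); zmod_eq.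
Qed.

Definition subrel V (G' Z' : D -> set V) : reldiff R D := Reldiff (dif V) G' Z'.

Arguments subrel : clear implicits.

(** * Koszul complexes as iterated cones *)

Section Koszul.
Context (I : eqType) (x : I -> R) (e : I -> D).
Hypothesis hx : forall i, hom (e i) (x i).

(** The head of [s] is the innermost cone, so an induction on [s] replaces [V] by a cone over it,
    and the first variable can be traded for a quotient of [V]. *)
Fixpoint koszul (s : seq I) V : reldiff R D :=
  if s is i :: s' then koszul s' (mulcone (x i) (e i) V) else V.

Lemma koszulP s V : reldiffP V -> reldiffP (koszul s V).
Proof. by elim: s V => //= i s IH V okV; exact/IH/mulconeP. Qed.

Lemma koszul_torsion s V f b : reldiffP V -> hom b f ->
  torsion V f b -> torsion (koszul s V) f b.
Proof.
move=> + hf; elim: s V => //= i s IH V okV tf.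
by apply: IH; [exact: mulconeP|exact: mulcone_torsion].
Qed.

Lemma koszul_torsion_self s V i : reldiffP V -> i \in s ->
  torsion (koszul s V) (x i) (e i).
Proof.
elim: s V => //= j s IH V okV; rewrite inE => /predU1P[->|]; last exact/IH/mulconeP.
by apply: koszul_torsion => //; [exact: mulconeP|exact: mulcone_torsion_self].
Qed.

Lemma koszul_bijmul s V f b : reldiffP V -> hom b f ->
  bijmul V f b -> bijmul (koszul s V) f b.
Proof.
move=> + hf; elim: s V => //= i s IH V okV tf.
by apply: IH; [exact: mulconeP|exact: mulcone_bijmul].
Qed.

Lemma koszul_short_exact s U V W : reldiffP U -> reldiffP V -> reldiffP W ->
  short_exact U V W -> short_exact (koszul s U) (koszul s V) (koszul s W).
Proof.
elim: s U V W => //= i s IH U V W okU okV okW ex.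
by apply: IH; try exact: mulconeP; exact: mulcone_short_exact.
Qed.

Lemma koszul_acyclic s V : reldiffP V -> (forall a, acyclic V a) ->
  forall a, acyclic (koszul s V) a.
Proof.
elim: s V => //= i s IH V okV ac; apply: IH; first exact: mulconeP.
by move=> a; exact: mulcone_acyclic.
Qed.

(** One variable at a time; torsion for the variables still to come survives each cone, as the
    descent in [acyclic_of_mulcone] requires. *)
Lemma koszul_acyclicP s V (Y : D -> Prop) : reldiffP V ->
  (forall i a, i \in s -> Y a -> Y (e i + a)) ->
  (forall i, i \in s -> torsion V (x i) (e i)) ->
  (forall a, Y a -> acyclic V a) <-> (forall a, Y a -> acyclic (koszul s V) a).
Proof.
elim: s V => //= i s IH V okV Ye tx.
have Yi a : Y a -> Y (e i + a) by apply: Ye; rewrite mem_head.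
rewrite -IH; first last.
- by move=> j js; apply: mulcone_torsion => //; apply: tx; rewrite inE js orbT.
- by move=> j a js; apply: Ye; rewrite inE js orbT.
- exact: mulconeP.
split=> [ac a Ya|ac]; first by apply: mulcone_acyclic => //; apply: ac => //; exact: Yi.
by apply: acyclic_of_mulcone ac => //; apply: tx; rewrite mem_head.
Qed.

Lemma koszul_quasi_iso s U V W a : reldiffP U -> reldiffP V -> reldiffP W ->
  short_exact U V W -> (forall b, acyclic U b) ->
  (acyclic (koszul s V) a <-> acyclic (koszul s W) a).
Proof.
move=> okU okV okW ex acU; apply: (@short_exact_acyclic (koszul s U));
  try exact: koszulP; first exact: koszul_short_exact.
exact: koszul_acyclic.
Qed.

(** [f] is bijective on the Koszul complex, as on [V], and some power of it kills each homology
    class, since it is a combination of the [x i]. *)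
Lemma koszul_bijmul_acyclic s V (f : R) b : reldiffP V -> hom b f -> bijmul V f b ->
  (exists q : I -> R, (forall i, hom (b - e i) (q i))
     /\ f = \sum_(i <- s) q i * x i) ->
  forall a, acyclic (koszul s V) a.
Proof.
move=> okV hf bf [q [hq ef]].
apply: torsion_bijmul_acyclic (koszul_bijmul s okV hf bf) => //; first exact: koszulP.
rewrite ef big_tnth; apply: (torsion_sum (e := fun j => e (tnth (in_tuple s) j))) => //.
  exact: koszulP.
by move=> j; apply: koszul_torsion_self => //; exact: mem_tnth.
Qed.

End Koszul.
End Reldiff.

Arguments subrel {R D}.

(** * Finite sums and generated submodules *)

Lemma sum_by_label (I : eqType) (T : Type) (V : nmodType) (l : seq (I * T))
    (r : seq I) (f : I * T -> V) : uniq r -> {subset [seq q.1 | q <- l] <= r} ->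
  \sum_(q <- l) f q = \sum_(i <- r) \sum_(q <- l | q.1 == i) f q.
Proof.
move=> ur; elim: l => [|q l IH] sub.
  by rewrite big_nil big1 // => i _; rewrite big_nil.
rewrite big_cons IH; last by move=> i il; apply: sub; rewrite inE il orbT.
have qr : q.1 \in r by apply: sub; rewrite inE eqxx.
rewrite !(bigD1_seq q.1 qr ur) /= [in RHS]big_cons eqxx addrA; congr (_ + _).
by apply: eq_bigr => i /negbTE ne; rewrite big_cons eq_sym ne.
Qed.

Section Span.
Context (R : comNzRingType) (V : lmodType R).
Implicit Types A B : set V.

Lemma span0 A : span A 0.
Proof. by exists [::] => //; rewrite big_nil. Qed.

Lemma spanN A x : span A x -> span A (- x).
Proof. by rewrite -scaleN1r; exact: spanZ. Qed.

Lemma spanB A x y : span A x -> span A y -> span A (x - y).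
Proof. by move=> sx /spanN; exact: spanD. Qed.

Lemma mem_span A x : A x -> span A x.
Proof.
move=> Ax; exists [:: (1, x)]; last by rewrite big_seq1 scale1r.
by move=> q; rewrite inE => /eqP ->.
Qed.

Lemma span_min A B : B 0 -> (forall a x y, B x -> B y -> B (a *: x + y)) ->
  A `<=` B -> span A `<=` B.
Proof.
move=> B0 BD AB _ [s sA ->]; elim: s sA => [|q s IH] sA; first by rewrite big_nil.
rewrite big_cons; apply: BD; first by apply/AB/sA; rewrite mem_head.
by apply: IH => q' q's; apply: sA; rewrite inE q's orbT.
Qed.

Lemma span_sum A (I : Type) (r : seq I) (P : pred I) (F : I -> V) :
  (forall i, P i -> span A (F i)) -> span A (\sum_(i <- r | P i) F i).
Proof. by move=> h; elim/big_ind: _ => //; [exact: span0|exact: spanD]. Qed.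

End Span.

(** * The grading of the polynomial ring and homogeneous components *)

Section Graded.
Context (S : comNzRingType) (k : nat) (n : 'I_k -> nat).
Local Notation R := (polyring S n).
Local Notation Zk := 'rV[int]_k.
Local Notation pgr := (@pregraded S k n).
Implicit Types (v w : vars n) (a b c : Zk).

Lemma polycompP a (f : R) : polycomp a f <-> (forall m, zdeg m != a -> f@_m = 0).
Proof.
split=> h m.
  by move=> /eqP ne; apply: memN_msupp_eq0; apply/negP => /h.
by rewrite mcoeff_msupp => nz; apply/eqP; apply: contraNT nz => /h ->.
Qed.

Lemma zdegD (m1 m2 : 'X_{1..#|{: vars n}|}) :
  @zdeg k n (m1 + m2)%MM = zdeg m1 + zdeg m2.
Proof. by rewrite /zdeg -big_split; apply: eq_bigr => v _; rewrite mnmDE mulrnDr. Qed.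

Lemma polycomp0 a : polycomp a (0 : R).
Proof. by apply/polycompP => m _; rewrite mcoeff0. Qed.

Lemma polycompD a (f g : R) : polycomp a f -> polycomp a g -> polycomp a (f + g).
Proof.
move=> /polycompP hf /polycompP hg; apply/polycompP => m ne.
by rewrite mcoeffD hf // hg // addr0.
Qed.

Lemma polycompN a (f : R) : polycomp a f -> polycomp a (- f).
Proof. by move=> /polycompP hf; apply/polycompP => m ne; rewrite mcoeffN hf ?oppr0. Qed.

Lemma polycomp_sum a (I : Type) (r : seq I) (P : pred I) (F : I -> R) :
  (forall i, P i -> polycomp a (F i)) -> polycomp a (\sum_(i <- r | P i) F i).
Proof. by move=> h; elim/big_ind: _ => //; [exact: polycomp0|exact: polycompD]. Qed.

Lemma polycompX m (s : S) : polycomp (zdeg m) (s *: 'X_[m] : R).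
Proof.
apply/polycompP => m' ne; rewrite mcoeffZ mcoeffX.
by case: eqP => [e|]; rewrite ?mulr0 // e eqxx in ne *.
Qed.

Lemma zdeg0 : @zdeg k n 0%MM = 0.
Proof. by rewrite /zdeg big1 // => v _; rewrite mnm0E mulr0n. Qed.

Lemma polycomp1 : polycomp 0 (1 : R).
Proof.
by have := @polycompX 0%MM 1; rewrite zdeg0 scale1r mpolyX0.
Qed.

Lemma polycompM a b (f g : R) :
  polycomp a f -> polycomp b g -> polycomp (a + b) (f * g).
Proof.
move=> hf hg; rewrite [f]mpolyE [g]mpolyE mulr_suml big_seq; apply: polycomp_sum.
move=> m mf; rewrite mulr_sumr big_seq; apply: polycomp_sum => m' mg.
rewrite -scalerAl -scalerAr scalerA -mpolyXD -(hf _ mf) -(hg _ mg) -zdegD.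
exact: polycompX.
Qed.

Definition var v : R := 'X_(enum_rank v).
Definition vdeg v : Zk := e_ (tag v).

Lemma polycomp_var v : polycomp (vdeg v) (var v).
Proof.
have -> : vdeg v = zdeg U_(enum_rank v)%MM.
  rewrite /zdeg (bigD1 v) //= mnm1E eqxx mulr1n big1 ?addr0 // => w ne.
  by rewrite mnm1E (inj_eq enum_rank_inj) eq_sym (negbTE ne) mulr0n.
by have := @polycompX U_(enum_rank v)%MM 1; rewrite scale1r.
Qed.

Lemma gring_graded : is_graded (gring S n).
Proof.
split=> /=.
- exact: polycomp0.
- by move=> a x y hx hy; exact/polycompD/polycompN.
- by move=> a b f g; exact: polycompM.
- move=> f; exists (undup [seq zdeg m | m <- msupp f]).
  exists (fun a => \sum_(m <- msupp f | zdeg m == a) f@_m *: 'X_[m]); split.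
    by move=> a; apply: polycomp_sum => m /eqP <-; exact: polycompX.
  rewrite {1}[f]mpolyE.
  have := @sum_by_label _ _ R [seq (zdeg m, m) | m <- msupp f]
    (undup [seq zdeg m | m <- msupp f]) (fun q => f@_q.2 *: 'X_[q.2]) (undup_uniq _).
  rewrite big_map => -> /=; last by move=> a; rewrite mem_undup -map_comp.
  by apply: eq_bigr => a _; rewrite big_map.
- move=> s c us hc sum0 a as_; apply/mpolyP => m; rewrite mcoeff0.
  have [e|/eqP ne] := eqVneq (zdeg m) a; last by move/polycompP: (hc a) => -> //; exact/eqP.
  have := congr1 (mcoeff m) sum0; rewrite mcoeff0 (bigD1_seq a) //= mcoeffD.
  rewrite (raddf_sum (mcoeff m)) big1 /= ?addr0 // => b ne.
  by move/polycompP: (hc b) => -> //; rewrite e eq_sym.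
Qed.

(** A relation between [x] and [y], since [gcomp_sum] gives decompositions without choosing one.
    Degrees may repeat in [l], so that adding decompositions is concatenation. *)
Definition component (N : pgr) a (x y : N) : Prop := gcomp a y /\
  exists2 l : seq (Zk * N), (forall q, q \in l -> gcomp q.1 q.2 /\ q.1 != a)
    & x = y + \sum_(q <- l) q.2.

Section Component.
Variables (N : pgr) (gN : is_graded N).

Lemma gcompN a (x : N) : gcomp a x -> gcomp a (- x).
Proof. by rewrite -sub0r; exact/(gcompB gN)/(gcomp0 gN). Qed.

Lemma gcompD a (x y : N) : gcomp a x -> gcomp a y -> gcomp a (x + y).
Proof. by move=> hx hy; rewrite -[y]opprK; exact/(gcompB gN)/gcompN. Qed.

Lemma gcomp_bigsum a (I : Type) (r : seq I) (P : pred I) (F : I -> N) :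
  (forall i, P i -> gcomp a (F i)) -> gcomp a (\sum_(i <- r | P i) F i).
Proof. by move=> h; elim/big_ind: _ => //; [exact: (gcomp0 gN)|exact: gcompD]. Qed.

Lemma component_ex a x : exists y, @component N a x y.
Proof.
have [s [c [hc ->]]] := gcomp_sum gN x.
exists (\sum_(b <- s | b == a) c b); split.
  by apply: gcomp_bigsum => b /eqP <-.
exists [seq (b, c b) | b <- s & b != a].
  by move=> q /mapP[b]; rewrite mem_filter => /andP[ne _] ->.
by rewrite big_map big_filter (bigID (fun b => b == a)).
Qed.

Lemma componentD a x y x' y' : @component N a x y -> component a x' y' ->
  component a (x + x') (y + y').
Proof.
move=> [hy [l hl ->]] [hy' [l' hl' ->]]; split; first exact: gcompD.
exists (l ++ l'); first by move=> q; rewrite mem_cat => /orP[/hl|/hl'].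
by rewrite big_cat /= addrACA.
Qed.

Lemma componentZ a b f x y : polycomp b f -> @component N a x y ->
  component (b + a) (f *: x) (f *: y).
Proof.
move=> hf [hy [l hl ->]]; split; first exact: (gcompZ gN).
exists [seq (b + q.1, f *: q.2) | q <- l].
  move=> _ /mapP[q /hl[h ne] ->]; split => /=; first exact: (gcompZ gN).
  by rewrite (inj_eq (addrI b)).
by rewrite scalerDr scaler_sumr big_map.
Qed.

Lemma component_self a x : gcomp a x -> @component N a x x.
Proof. by move=> h; split=> //; exists [::] => //; rewrite big_nil addr0. Qed.

Lemma component0 a y : @component N a 0 y -> y = 0.
Proof.
move=> [hy [l hl]].
(* Directness concerns distinct degrees, so the terms of [l] are collected by degree; [y] then
   stands alone in degree [a]. *)
set r := undup [seq q.1 | q <- l].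
have ar : a \notin r.
  by rewrite mem_undup; apply/mapP => -[q /hl[_ /eqP ne] /esym].
rewrite (@sum_by_label _ _ _ _ r) ?undup_uniq //; last by move=> b; rewrite mem_undup.
move=> /esym sum0.
pose c b : N := if b == a then y else \sum_(q <- l | q.1 == b) q.2.
have := @gcomp_direct _ _ _ _ gN (a :: r) c; rewrite /= ar undup_uniq => /(_ isT).
have hc b : gcomp b (c b).
  rewrite /c; case: eqP => [-> //|_]; rewrite big_seq_cond; apply: gcomp_bigsum.
  by move=> q /andP[/hl[h _] /eqP <-].
move=> /(_ hc); rewrite big_cons {1}/c eqxx.
rewrite (eq_big_seq (fun b => \sum_(q <- l | q.1 == b) q.2)).
  by move=> /(_ sum0 a); rewrite mem_head /c eqxx => ->.
by move=> b br; rewrite /c; case: eqP => // e; rewrite -e br in ar.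
Qed.

Definition proj a (x : N) : N := xget 0 (component a x).

Lemma projP a x : component a x (proj a x).
Proof. by rewrite /proj; have [y hy] := component_ex a x; case: xgetP => // /(_ y). Qed.

Lemma proj_eq a x y : component a x y -> proj a x = y.
Proof.
move=> h; apply/eqP; rewrite -subr_eq0; apply/eqP/(@component0 a).
rewrite -(subrr x); apply: componentD; first exact: projP.
by have := componentZ (polycompN polycomp1) h; rewrite !scaleN1r add0r.
Qed.

Lemma gcomp_proj a x : gcomp a (proj a x).
Proof. by case: (projP a x). Qed.

Lemma projD a x y : proj a (x + y) = proj a x + proj a y.
Proof. by apply: proj_eq; apply: componentD; exact: projP. Qed.

Lemma proj_id a x : gcomp a x -> proj a x = x.
Proof. by move=> h; apply: proj_eq; exact: component_self. Qed.

Lemma proj0 a : proj a 0 = 0.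
Proof. exact/proj_id/(gcomp0 gN). Qed.

Lemma projZ a b f x : polycomp b f -> proj (b + a) (f *: x) = f *: proj a x.
Proof. by move=> hf; apply: proj_eq; apply: componentZ => //; exact: projP. Qed.

Lemma projN a x : proj a (- x) = - proj a x.
Proof.
have := projZ a x (polycompN polycomp1).
by rewrite add0r !scaleN1r.
Qed.

Lemma projB a x y : proj a (x - y) = proj a x - proj a y.
Proof. by rewrite projD projN. Qed.

Lemma proj_sum a (I : Type) (r : seq I) (P : pred I) (F : I -> N) :
  proj a (\sum_(i <- r | P i) F i) = \sum_(i <- r | P i) proj a (F i).
Proof. by apply: (big_morph _ (projD a)); exact: proj0. Qed.

End Component.

Lemma proj_degree0 (N N' : pgr) (gN : is_graded N) (gN' : is_graded N')
    (f : N -> N') a x : linear f -> degree0 f -> proj a (f x) = f (proj a x).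
Proof.
move=> lf df; apply: (proj_eq gN').
have fD y z : f (y + z) = f y + f z by have := lf 1 y z; rewrite !scale1r.
have f0 : f 0 = 0 by apply: (@addrI _ (f 0)); rewrite -fD !addr0.
have [hy [l hl e]] := projP gN a x; split; first exact: df.
exists [seq (q.1, f q.2) | q <- l].
  by move=> _ /mapP[q /hl[h ne] ->]; split=> //; exact: df.
by rewrite {1}e fD big_map (big_morph f fD f0).
Qed.

(** Replace each coefficient by its component of degree [b - e i]; the whole sum is already its own
    component of degree [b]. *)
Lemma homogeneous_combination (I : finType) b (e : I -> Zk) (q f : I -> R) :
  polycomp b (\sum_i q i * f i) -> (forall i, polycomp (e i) (f i)) ->
  exists2 q', forall i, polycomp (b - e i) (q' i)
    & \sum_i q i * f i = \sum_i q' i * f i.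
Proof.
move=> hb hf; pose q' i : R := @proj (gring S n) (b - e i) (q i).
exists q' => [i|]; first exact: (gcomp_proj gring_graded).
rewrite -[LHS](@proj_id _ gring_graded b _ hb) (proj_sum gring_graded).
apply: eq_bigr => i _; rewrite mulrC [RHS]mulrC.
have := projZ gring_graded (b - e i) (q i : gring S n) (hf i).
by rewrite addrC subrK.
Qed.

(** * The submodule generated by a set of variables *)

Definition varmul (V : lmodType R) (s : seq (vars n)) : set V :=
  [set u | exists v (c : V), v \in s /\ u = var v *: c].

(* the degree [a] part of the same submodule, with homogeneous coefficients *)
Fixpoint gvarmul (N : pgr) (s : seq (vars n)) a : set N :=
  if s is v :: s' then [set u | exists (z c : N),
    [/\ @gvarmul N s' a z, gcomp (a - vdeg v) c & u = z + var v *: c]]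
  else [set 0].

Arguments varmul : clear implicits.
Arguments gvarmul : clear implicits.

Section Varmul.
Variables (N : pgr) (gN : is_graded N).

Lemma gvarmul_gcomp s a u : gvarmul N s a u -> gcomp a u.
Proof.
elim: s u => [u ->|v s IH u [z [c [hz hc ->]]]]; first exact: (gcomp0 gN).
apply: (gcompD gN); first exact: IH.
by rewrite -[a](subrK (vdeg v)) addrC; apply: (gcompZ gN) => //; exact: polycomp_var.
Qed.

Lemma gvarmul0 s a : gvarmul N s a 0.
Proof.
elim: s => //= v s IH; exists 0, 0; split=> //; first exact: (gcomp0 gN).
by rewrite scaler0 addr0.
Qed.

Lemma gvarmulB s a x y : gvarmul N s a x -> gvarmul N s a y -> gvarmul N s a (x - y).
Proof.
elim: s x y => [x y -> ->|v s IH x y]; first by rewrite subr0.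
move=> [z [c [hz hc ->]]] [z' [c' [hz' hc' ->]]]; exists (z - z'), (c - c').
split; [exact: IH|exact: (gcompB gN)|rewrite scalerBr; zmod_eq].
Qed.

Lemma gvarmulD s a x y : gvarmul N s a x -> gvarmul N s a y -> gvarmul N s a (x + y).
Proof.
move=> hx hy; rewrite -[y]opprK; apply: gvarmulB => //.
by rewrite -sub0r; apply: gvarmulB => //; exact: gvarmul0.
Qed.

Lemma gvarmulZ s a b f x : polycomp b f -> gvarmul N s a x -> gvarmul N s (b + a) (f *: x).
Proof.
move=> hf; elim: s x => [x -> /=|v s IH x [z [c [hz hc ->]]]]; first by rewrite scaler0.
exists (f *: z), (f *: c); split; first exact: IH.
  by rewrite -addrA; exact: (gcompZ gN).
by rewrite scalerDr !scalerA mulrC.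
Qed.

Lemma gvarmul_var s v a (c : N) : v \in s -> gcomp (a - vdeg v) c -> gvarmul N s a (var v *: c).
Proof.
elim: s => //= w s IH; rewrite inE => /predU1P[<- hc|vs hc].
  by exists 0, c; split; rewrite ?add0r //; exact: gvarmul0.
exists (var v *: c), 0; split; [exact: IH|exact: (gcomp0 gN)|].
by rewrite scaler0 addr0.
Qed.

Lemma gvarmul_span s a u : gvarmul N s a u -> span (varmul N s) u.
Proof.
elim: s u => [u ->|v s IH u [z [c [/IH hz hc ->]]]]; first exact: span0.
apply: spanD; last by apply: mem_span; exists v, c; rewrite mem_head.
apply: span_min hz; [exact: span0|by move=> *; apply: spanD => //; exact: spanZ|].
by move=> _ [w [d [ws ->]]]; apply: mem_span; exists w, d; rewrite inE ws orbT.
Qed.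

Lemma gvarmul_proj s a u : span (varmul N s) u -> gvarmul N s a (proj a u).
Proof.
case=> l hl ->; rewrite (proj_sum gN) big_seq.
elim/big_ind: _ => [||q /hl[v [c [vs ->]]]]; [exact: gvarmul0|exact: gvarmulD|].
rewrite scalerA mulrC -scalerA -[a](subrK (vdeg v)) addrC.
rewrite (projZ gN _ _ (@polycomp_var v)) addrC subrK.
by apply: gvarmul_var => //; exact: (gcomp_proj gN).
Qed.

(** [gvarmul] carries degrees through the complexes, while [span] suits the regularity argument in a
    basis, where coordinates need not be homogeneous. *)
Lemma gvarmulP s a u : gcomp a u -> gvarmul N s a u <-> span (varmul N s) u.
Proof.
move=> hu; split; first exact: gvarmul_span.
by move=> /(gvarmul_proj a); rewrite (proj_id gN).
Qed.

End Varmul.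

Lemma gvarmul_degree0 (N N' : pgr) (f : {linear N -> N'}) s a u :
  degree0 f -> gvarmul N s a u -> gvarmul N' s a (f u).
Proof.
move=> df; elim: s u => [u ->|v s IH u [z [c [hz hc ->]]]]; first by rewrite /= linear0.
by exists (f z), (f c); split; [exact: IH|exact: df|rewrite linearD linearZ].
Qed.

(* the ideal generated by the variables in [s], described by coefficients *)
Definition varideal (s : seq (vars n)) : set R :=
  [set f | forall m : 'X_{1..#|{: vars n}|},
     (forall v, v \in s -> m (enum_rank v) = 0%N) -> f@_m = 0].

Lemma varideal_var s v (f : R) : v \in s -> varideal s (var v * f).
Proof.
move=> vs m hm; apply: memN_msupp_eq0; rewrite mulrC (perm_mem (msuppMX _ _)).
by apply/mapP => -[m' _ e]; have := hm v vs; rewrite e mnmDE mnm1E eqxx.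
Qed.

(** Multiplication by [var v] shifts exponents by [U_(enum_rank v)], which involves no variable of
    [s], so the coefficients that must vanish reappear unchanged. *)
Lemma varideal_regular s v (f : R) : v \notin s -> varideal s (var v * f) -> varideal s f.
Proof.
move=> vs h m hm; have := h (U_(enum_rank v) + m)%MM; rewrite mulrC mcoeffMX; apply.
move=> w ws; rewrite mnmDE hm // addn0 mnm1E (inj_eq enum_rank_inj).
by case: eqP => // e; rewrite e ws in vs.
Qed.

Lemma varideal_span (V : lmodType R) s (f : R) (x : V) :
  varideal s f -> span (varmul V s) (f *: x).
Proof.
move=> hf; rewrite [f]mpolyE scaler_suml big_seq; apply: span_sum => m mf.
have [v vs mv] : exists2 v, v \in s & m (enum_rank v) != 0%N.
  apply: contrapT => none; move: mf; rewrite mcoeff_msupp hf ?eqxx // => v vs.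
  by apply/eqP/negPn/negP => ne; apply: none; exists v.
have le : (U_(enum_rank v) <= m)%MM by rewrite lep1mP.
rewrite -[in 'X_[m]](submK le) mpolyXD mulrC scalerAr -scalerA.
by apply: mem_span; exists v; eexists.
Qed.

(** In a basis, membership in the submodule generated by the variables of [s] means that all
    coordinates lie in [varideal s]; regularity reduces to that of polynomials. *)
Lemma free_var_regular (N : pgr) s v (u : N) : graded_free N -> v \notin s ->
  span (varmul N s) (var v *: u) -> span (varmul N s) u.
Proof.
move=> [I [b [_ [_ gen free]]]] vs.
(* Expansions are lists that may repeat a basis label: sums become concatenations, and [coef]
   collects a coordinate. *)
pose coef i (l : seq (I * R)) := \sum_(q <- l | q.1 == i) q.2.
pose comb (l : seq (I * R)) : N := \sum_(q <- l) q.2 *: b q.1.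
have combE l : comb l = \sum_(i <- undup [seq q.1 | q <- l]) coef i l *: b i.
  rewrite /comb (@sum_by_label _ _ _ _ (undup [seq q.1 | q <- l])) ?undup_uniq //.
    by apply: eq_bigr => i _; rewrite scaler_suml; apply: eq_bigr => q /eqP ->.
  by move=> i; rewrite mem_undup.
have comb0 l i : comb l = 0 -> coef i l = 0.
  rewrite combE => /(free _ (coef^~ l) (undup_uniq _)) h.
  have [/h //|il] := boolP (i \in undup [seq q.1 | q <- l]).
  rewrite /coef big1_seq // => q /andP[/eqP qi ql].
  by case/negP: il; rewrite mem_undup -qi map_f.
have combP x : exists l, x = comb l.
  by have [t [c ->]] := gen x; exists [seq (i, c i) | i <- t]; rewrite /comb big_map.
have scal f l : f *: comb l = comb [seq (q.1, f * q.2) | q <- l].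
  by rewrite /comb big_map scaler_sumr; apply: eq_bigr => q _; rewrite scalerA.
have coefZ f l i : coef i [seq (q.1, f * q.2) | q <- l] = f * coef i l.
  by rewrite /coef big_map mulr_sumr.
have coef_inj l l' i : comb l = comb l' -> coef i l = coef i l'.
  move=> e; pose l0 := l ++ [seq (q.1, -1 * q.2) | q <- l'].
  have combN : comb [seq (q.1, -1 * q.2) | q <- l'] = - comb l'.
    by rewrite -scal scaleN1r.
  have := @comb0 l0 i; rewrite /l0 {1}/comb {1}/coef !big_cat /=.
  rewrite -[X in _ + X = _ -> _]/(comb (map _ l')) combN -[X in X - _]/(comb l) e subrr.
  move=> /(_ erefl)/eqP; rewrite -[X in _ + X]/(coef i (map _ l')) coefZ mulN1r.
  by rewrite subr_eq0 => /eqP.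
have spanI x l i : span (varmul N s) x -> x = comb l -> varideal s (coef i l).
  move=> [t ht ->]; elim: t l ht => [|q t IH] l ht e.
    by rewrite comb0 => [m _|]; [exact: mcoeff0|rewrite -e big_nil].
  have [lt et] := combP (\sum_(q <- t) q.1 *: q.2).
  have [w [c [ws ec]]] := ht q (mem_head _ _); have [lc elc] := combP c.
  rewrite big_cons et ec elc scalerA mulrC scal in e.
  rewrite (coef_inj l ([seq (q0.1, var w * q.1 * q0.2) | q0 <- lc] ++ lt)); last first.
    by rewrite -e /comb big_cat.
  rewrite /coef big_cat -/(coef i lt) -/(coef i (map _ _)) coefZ -mulrA.
  move=> m hm; rewrite mcoeffD (varideal_var _ ws) // add0r.
  by apply: (IH lt _ et) => // q' q't; apply: ht; rewrite inE q't orbT.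
have [l el] := combP u; rewrite {1}el scal => h.
rewrite el combE; apply: span_sum => i _; apply: varideal_span.
by apply: (varideal_regular vs); rewrite -coefZ; exact: spanI h erefl.
Qed.

End Graded.

Arguments varmul {S k n} V s.
Arguments gvarmul {S k n} N s a.

(** * Localization *)

Section Localization.
Context (R : comNzRingType) (V : lmodType R).
Implicit Types (f h : R) (x y : V).

Lemma fracD f x y m : frac f x m + frac f y m = frac f (x + y) m.
Proof. exact: (etrans (ladd_frac f x m y m) (frac_sum f x y m)). Qed.

Lemma fracZ f a x m : a *: frac f x m = frac f (a *: x) m.
Proof. exact: (lscale_frac f a x m). Qed.

Lemma frac_expand f x m j : frac f x m = frac f (f ^+ j *: x) (j + m).
Proof. by apply/frac_eq; exists 0%N; rewrite !add0n scalerA -exprD addnC. Qed.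

Lemma frac_eq0 f x m : frac f x m = 0 <-> exists a, f ^+ a *: x = 0.
Proof.
rewrite (_ : 0 = frac f 0 0) // frac_eq.
by split=> -[a e]; exists a; move: e; rewrite scaler0 addn0.
Qed.

Lemma frac0 f m : frac f (0 : V) m = 0.
Proof. by apply/frac_eq0; exists 0%N; rewrite scaler0. Qed.

Lemma frac_ex f (u : loc V f) : exists x m, u = frac f x m.
Proof. by exists (numer u), (expon u); rewrite frac_repr. Qed.

Lemma scale_loc_inj f (u : loc V f) N : f ^+ N *: u = 0 -> u = 0.
Proof.
have [x [m ->]] := frac_ex u; rewrite fracZ => /frac_eq0[a e].
by apply/frac_eq0; exists (a + N)%N; rewrite exprD -scalerA.
Qed.

Section Map.
Variables (f f' h : R).
Hypothesis ef : f' = f * h.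

Lemma loc_map_linear : linear (@loc_map R V f f' h).
Proof.
move=> a u v; have [x [m ->]] := frac_ex u; have [y [l ->]] := frac_ex v.
rewrite (frac_expand f x m l) (frac_expand f y l m) [(m + l)%N]addnC.
rewrite fracZ fracD !loc_mapE // fracZ fracD; congr frac.
by rewrite scalerDr !scalerA [_ * a]mulrC mulrA.
Qed.

Lemma loc_map0 : @loc_map R V f f' h 0 = 0.
Proof.
have := loc_map_linear 1 0 0; rewrite scale1r addr0 => e.
by apply: (@addrI _ (@loc_map R V f f' h 0)); rewrite addr0 {3}e scale1r.
Qed.

Lemma loc_mapZ a u : @loc_map R V f f' h (a *: u) = a *: loc_map f' h u.
Proof. by have := loc_map_linear a u 0; rewrite loc_map0 !addr0. Qed.

Lemma loc_map_sum (I : Type) (r : seq I) (P : pred I) (F : I -> loc V f) :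
  loc_map f' h (\sum_(i <- r | P i) F i) = \sum_(i <- r | P i) loc_map f' h (F i).
Proof.
apply: (big_morph (@loc_map R V f f' h)) => [u v|]; last exact: loc_map0.
by have := loc_map_linear 1 u v; rewrite !scale1r.
Qed.

Lemma loc_map_comp f'' h' u : f'' = f' * h' ->
  loc_map f'' h' (@loc_map R V f f' h u) = loc_map f'' (h * h') u.
Proof.
have [x [m ->]] := frac_ex u => ef''.
have e3 : f'' = f * (h * h') by rewrite ef'' ef mulrA.
by rewrite !loc_mapE // scalerA mulrC -exprMn.
Qed.

Lemma loc_map_eq0 u : @loc_map R V f f' h u = 0 -> exists N, h ^+ N *: u = 0.
Proof.
have [x [m ->]] := frac_ex u; rewrite loc_mapE // => /frac_eq0[a].
rewrite scalerA ef exprMn -mulrA -exprD => e; exists (a + m)%N.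
by rewrite fracZ; apply/frac_eq0; exists a; rewrite scalerA.
Qed.

End Map.

End Localization.

Lemma sum_antisym (V : zmodType) (r : nat) (A : {set 'I_r}) (F : 'I_r -> 'I_r -> V) :
  (forall s t, s \in A -> t \in A -> (s < t)%N -> F t s = - F s t) ->
  \sum_(t in A) \sum_(s in A :\ t) F t s = 0.
Proof.
move=> anti; rewrite pair_big_dep /= (bigID (fun q : 'I_r * 'I_r => (q.1 < q.2)%N)) /=.
rewrite [X in _ + X](reindex_inj (h := fun q : 'I_r * 'I_r => (q.2, q.1))) /=; last first.
  by move=> [? ?] [? ?] [-> ->].
rewrite [X in _ + X](eq_bigl (fun q : 'I_r * 'I_r =>
    [&& q.1 \in A, q.2 \in A :\ q.1 & (q.1 < q.2)%N])); last first.
  move=> [s t] /=; rewrite !inE -leqNgt [t == s]eq_sym leq_eqVlt.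
  case: (eqVneq s t) => //= [_|ne]; rewrite ?andbF //.
  by case: eqVneq => [/val_inj e|_]; [rewrite e eqxx in ne|case: (s \in A); case: (t \in A)].
rewrite (eq_bigl (fun q : 'I_r * 'I_r =>
    [&& q.1 \in A, q.2 \in A :\ q.1 & (q.1 < q.2)%N])); last by move=> q; rewrite -andbA.
rewrite -big_split big1 //= => -[s t] /= /and3P[sA]; rewrite !inE => /andP[_ tA] lt.
by rewrite (anti s t) // subrr.
Qed.

Section DprodE.
Context (R : comNzRingType) (I : finType) (V : I -> lmodType R).
Implicit Types u v : dprod V.

Lemma dprodD u v i : (u + v) i = u i + v i. Proof. exact: ffunE. Qed.
Lemma dprodN u i : (- u) i = - u i. Proof. exact: ffunE. Qed.
Lemma dprod0 i : (0 : dprod V) i = 0. Proof. exact: ffunE. Qed.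
Lemma dprodZ a u i : (a *: u) i = a *: u i. Proof. exact: ffunE. Qed.

End DprodE.

Record graded_part (R : comNzRingType) (D : zmodType) (hom : D -> set R)
    (V : lmodType R) (gc : D -> set V) : Prop := GradedPart {
  gc0 : forall a, gc a 0;
  gcB : forall a x y, gc a x -> gc a y -> gc a (x - y);
  gcZ : forall a b f x, hom a f -> gc b x -> gc (a + b) (f *: x) }.

Section GradedLocalization.
Context (R : comNzRingType) (D : zmodType) (hom : D -> set R).
Hypothesis gr : gradation hom.
Variables (V : lmodType R) (gc : D -> set V).
Hypothesis gp : graded_part hom gc.
Implicit Types (f h : R) (a b c : D).

Definition gloc_part f c : set (loc V f) := [set u | exists a m x,
  [/\ hom a f, gc (c + a *+ m) x & u = frac f x m]].

(** For nonzero [f] the degree is unique, and for [f = 0] the localization is zero, so any one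
    degree of [f] may be fixed. *)
Lemma gloc_partP f a c (u : loc V f) : hom a f ->
  gloc_part c u <-> exists m x, gc (c + a *+ m) x /\ u = frac f x m.
Proof.
move=> hf; split=> [[b [m [x [hb hx ->]]]]|[m [x [hx ->]]]]; last by exists a, m, x.
have [f0|nz] := pselect (f = 0); last first.
  by rewrite -(hom_uniq gr hb hf nz); exists m, x.
exists 0%N, 0; rewrite mulr0n; split; first exact: (gc0 gp).
by rewrite frac0; apply/frac_eq0; exists 1%N; rewrite f0 expr1 scale0r.
Qed.

Section Homogeneous.
Variables (f : R) (a : D).
Hypothesis hf : hom a f.

Lemma gloc_numer c (u : loc V f) : gloc_part c u -> exists m0, forall m, (m0 <= m)%N ->
  exists2 x, gc (c + a *+ m) x & u = frac f x m.
Proof.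
move=> /(gloc_partP _ _ hf)[m0 [x [hx ->]]]; exists m0 => m le.
exists (f ^+ (m - m0) *: x); last by rewrite [LHS](frac_expand f x m0 (m - m0)) subnK.
rewrite -{1}(subnK le) mulrnDr addrCA; apply: (gcZ gp) => //.
exact: (homX gr).
Qed.

Lemma gloc_part0 c : gloc_part c (0 : loc V f).
Proof.
apply/(gloc_partP _ _ hf); exists 0%N, 0; split; last by rewrite frac0.
exact: (gc0 gp).
Qed.

Lemma gloc_partB c (u v : loc V f) : gloc_part c u -> gloc_part c v -> gloc_part c (u - v).
Proof.
move=> /gloc_numer[m1 h1] /gloc_numer[m2 h2].
have [x hx ->] := h1 _ (leq_maxl m1 m2); have [y hy ->] := h2 _ (leq_maxr m1 m2).
apply/(gloc_partP _ _ hf); eexists; eexists; rewrite -scaleN1r fracZ fracD scaleN1r.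
by split; [|reflexivity]; exact: (gcB gp).
Qed.

Lemma gloc_partZ b c (q : R) (u : loc V f) :
  hom b q -> gloc_part c u -> gloc_part (b + c) (q *: u).
Proof.
move=> hq /(gloc_partP _ _ hf)[m [x [hx ->]]]; apply/(gloc_partP _ _ hf).
by exists m, (q *: x); rewrite fracZ -addrA; split=> //; exact: (gcZ gp).
Qed.

Lemma gloc_divide c (u : loc V f) : gloc_part (a + c) u ->
  exists2 v : loc V f, gloc_part c v & u = f *: v.
Proof.
move=> /(gloc_partP _ _ hf)[m [x [hx ->]]]; exists (frac f x m.+1).
  apply/(gloc_partP _ _ hf); exists m.+1, x; split=> //.
  by rewrite mulrS addrCA addrA.
by rewrite fracZ (frac_expand f x m 1) expr1.
Qed.

Lemma gloc_map b c f' h (u : loc V f) : f' = f * h -> hom b h ->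
  gloc_part c u -> gloc_part c (loc_map f' h u).
Proof.
move=> ef hh /(gloc_partP _ _ hf)[m [x [hx ->]]]; rewrite loc_mapE //.
apply/(gloc_partP (a := a + b)); first by rewrite ef; exact: (homM gr).
exists m, (h ^+ m *: x); split=> //; rewrite mulrnDl [_ *+ m + _]addrC addrCA.
apply: (gcZ gp) => //.
exact: (homX gr).
Qed.

(** [h ^+ m0] clears the part of the denominator [(f * h) ^+ m0] coming from [h]. All large [m] are
    allowed because one exponent must later serve every face. *)
Lemma gloc_lift b c f' h (u : loc V f') : f' = f * h -> hom b h ->
  gloc_part c u -> exists m0, forall m, (m0 <= m)%N ->
  exists2 y : loc V f, gloc_part (c + b *+ m) y & loc_map f' h y = h ^+ m *: u.
Proof.
move=> ef hh; have hf' : hom (a + b) f' by rewrite ef; exact: (homM gr).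
move=> /(gloc_partP _ _ hf')[m0 [x [hx ->]]]; exists m0 => m le.
exists (h ^+ (m - m0) *: frac f x m0); last first.
  by rewrite loc_mapZ // loc_mapE // -fracZ scalerA -exprD subnK.
rewrite -[in b *+ m](subnK le) mulrnDr addrCA; apply: gloc_partZ.
  exact: (homX gr).
apply/(gloc_partP _ _ hf); exists m0, x; split=> //.
by rewrite -addrA -mulrnDl [b + a]addrC.
Qed.

End Homogeneous.

(** * The Cech complex *)

Section Cech.
Variables (r : nat) (g : 'I_r -> R) (alpha : 'I_r -> D).
Hypothesis hg : forall t, hom (alpha t) (g t).
Implicit Types (T : {set 'I_r}) (t : 'I_r).

Definition gpr T : R := \prod_(t in T) g t.

Definition csign t T : R := (-1) ^+ #|[pred s in T | (s < t)%N]|.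

Lemma gpr_D1 T t : t \in T -> gpr T = gpr (T :\ t) * g t.
Proof. by move=> tT; rewrite /gpr (big_setD1 t tT) mulrC. Qed.

Definition galpha T : D := \sum_(t in T) alpha t.

Lemma hom_gpr T : hom (galpha T) (gpr T).
Proof.
rewrite /galpha /gpr; apply: (big_ind2 hom) => [|? ? ? ?|t _].
- exact: (hom1 gr).
- exact: (homM gr).
- exact: hg.
Qed.

(** Faces of all sizes together, the empty one giving [V] localized at 1: this is the total Cech
    complex. *)
Definition cechsum : Type := dprod (fun T => loc V (gpr T)).
HB.instance Definition _ := GRing.Lmodule.on cechsum.

Definition cechdif (u : cechsum) : cechsum :=
  dprod_of (fun T => \sum_(t in T) csign t T *: loc_map (gpr T) (g t) (u (T :\ t))).

Lemma cechdifE u T : cechdif u T =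
  \sum_(t in T) csign t T *: loc_map (gpr T) (g t) (u (T :\ t)).
Proof. exact: ffunE. Qed.

Lemma cechdif_linear : linear cechdif.
Proof.
move=> a u v; apply/ffunP => T; rewrite dprodD dprodZ !cechdifE scaler_sumr -big_split.
apply: eq_bigr => t tT; rewrite dprodD dprodZ (loc_map_linear (gpr_D1 tT)).
by rewrite scalerDr !scalerA [csign t T * a]mulrC.
Qed.

(** Removing the smaller index [s] lowers by one the number of elements below [t], while removing
    [t] does not affect the number below [s]. *)
Lemma csign_swap T s t : s \in T -> t \in T -> (s < t)%N ->
  csign t T * csign s (T :\ t) = - (csign s T * csign t (T :\ s)).
Proof.
move=> sT tT lt; rewrite /csign.
have -> : #|[pred i in T :\ t | (i < s)%N]| = #|[pred i in T | (i < s)%N]|.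
  apply: eq_card => i; rewrite !inE; case: eqVneq => // -> /=.
  by rewrite [(t < s)%N]ltnNge ltnW ?andbF.
rewrite (cardD1 s [pred i in T | (i < t)%N]) !inE sT lt add1n exprS mulN1r mulNr mulrC.
congr (- (_ * _)); congr (_ ^+ _); apply: eq_card => i.
by rewrite !inE; case: (i != s).
Qed.

Lemma cechdif2 u : cechdif (cechdif u) = 0.
Proof.
apply/ffunP => T; rewrite dprod0 cechdifE.
(* Both orders of removing [s] and [t] compose to the same direct localization from the smaller
   face, recorded by [w]. *)
pose w T' := loc_map (gpr T) (gpr (T :\: T')) (u T').
rewrite (eq_bigr (fun t => \sum_(s in T :\ t)
    (csign t T * csign s (T :\ t)) *: w (T :\ t :\ s))); last first.
  move=> t tT; rewrite cechdifE (loc_map_sum (gpr_D1 tT)) scaler_sumr.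
  apply: eq_bigr => s sT; rewrite (loc_mapZ (gpr_D1 tT)) scalerA; congr (_ *: _).
  rewrite (loc_map_comp (gpr_D1 sT)); last exact: gpr_D1.
  rewrite /w; congr loc_map.
  move: sT; rewrite !inE => /andP[ne sT].
  have -> : T :\: (T :\ t :\ s) = [set s; t]%SET.
    apply/setP => i; rewrite !inE; case: (eqVneq i s) => [->|_] /=; first by rewrite sT.
    by case: eqVneq => [->|_] /=; [rewrite tT|case: (i \in T)].
  by rewrite /gpr big_setU1 ?inE //= big_set1.
apply: sum_antisym => s t sT tT lt; rewrite csign_swap // scaleNr; congr (- (_ *: w _)).
by apply/setP => i; rewrite !inE andbCA.
Qed.

Definition cech_part c : set cechsum :=
  [set u | forall T, gloc_part c (u T)].

(** Used as [Z], it leaves only the components indexed by [E]. *)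
Definition vanishing (E : {set {set 'I_r}}) c : set cechsum :=
  [set u | cech_part c u /\ forall T, T \in E -> u T = 0].

Definition cechquot E : reldiff R D := Reldiff cechdif cech_part (vanishing E).

(** The component of a differential at [T] involves only the faces [T :\ t], so this condition makes
    [vanishing E] stable. *)
Definition down_closed (E : {set {set 'I_r}}) :=
  forall T t, T \in E -> t \in T -> T :\ t \in E.

Lemma cech_part_dif c u : cech_part c u -> cech_part c (cechdif u).
Proof.
move=> hu T; rewrite cechdifE; have h0 := hom_gpr T.
elim/big_ind: _ => [|x y hx hy|t tT]; first exact: (gloc_part0 h0).
  rewrite -[y]opprK; apply: (gloc_partB h0) => //.
  by rewrite -sub0r; apply: (gloc_partB h0) => //; exact: (gloc_part0 h0).
rewrite -[c]add0r; apply: (gloc_partZ h0).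
  rewrite /csign -[0](mul0rn _ #|[pred s in T | (s < t)%N]|).
  apply: (homX gr).
  exact/(homN gr)/(hom1 gr).
exact: (gloc_map (hom_gpr (T :\ t)) (gpr_D1 tT) (@hg t)).
Qed.

Lemma vanishing_dif E c u : down_closed E -> vanishing E c u -> vanishing E c (cechdif u).
Proof.
move=> dD [hu u0]; split=> [|T TD]; first exact: cech_part_dif.
rewrite cechdifE big1 // => t tT; rewrite u0; last exact: dD.
by rewrite (loc_map0 _ (gpr_D1 tT)) scaler0.
Qed.

Lemma cech_part0 c : cech_part c 0.
Proof. by move=> T; rewrite dprod0; exact: (gloc_part0 (hom_gpr T)). Qed.

Lemma cech_partB c u v : cech_part c u -> cech_part c v -> cech_part c (u - v).
Proof.
move=> hu hv T; rewrite dprodD dprodN; exact: (gloc_partB (hom_gpr T)).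
Qed.

Lemma cech_partZ a c q u : hom a q -> cech_part c u -> cech_part (a + c) (q *: u).
Proof. by move=> hq hu T; rewrite dprodZ; exact: (gloc_partZ (hom_gpr T)). Qed.

Lemma vanishing0 E c : vanishing E c 0.
Proof. by split=> [|T _]; [exact: cech_part0|rewrite dprod0]. Qed.

Lemma vanishingB E c u v : vanishing E c u -> vanishing E c v -> vanishing E c (u - v).
Proof.
move=> [hu u0] [hv v0]; split=> [|T TD]; first exact: cech_partB.
by rewrite dprodD dprodN u0 // v0 // subrr.
Qed.

Lemma vanishingZ E a c q u :
  hom a q -> vanishing E c u -> vanishing E (a + c) (q *: u).
Proof.
move=> hq [hu u0]; split=> [|T TD]; first exact: cech_partZ.
by rewrite dprodZ u0 // scaler0.
Qed.

Lemma vanishing_setT c u : vanishing [set: {set 'I_r}]%SET c u <-> u = 0.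
Proof.
split=> [[_ u0]|->]; last exact: vanishing0.
by apply/ffunP => T; rewrite dprod0 u0 ?inE.
Qed.

Lemma cechquotP E : down_closed E -> reldiffP hom (cechquot E).
Proof.
move=> dD; split; [exact: cechdif_linear|exact: cech_part0|exact: cech_partB|
  exact: cech_partZ|exact: cech_part_dif|by move=> c u []|exact: vanishing0|
  exact: vanishingB|exact: vanishingZ| |].
- by move=> c u; exact: vanishing_dif.
- by move=> c u _ /=; rewrite cechdif2; exact: vanishing0.
Qed.

Lemma down_closed_setT : down_closed [set: {set 'I_r}]%SET.
Proof. by move=> T t; rewrite !inE. Qed.

(* For a cocycle [z], the components of [z] containing [t] are numerators over
   powers of [g t] of the components of a cochain [y], and [g t ^+ m *: z - d y]
   is then killed by a power of [g t]. *)
Lemma cech_torsion t : torsion (cechquot [set: {set 'I_r}]%SET) (g t) (alpha t).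
Proof.
move=> c z hz /vanishing_setT /= dz.
have lift T : exists m0, forall m, (m0 <= m)%N -> exists y : loc V (gpr T),
    gloc_part (c + alpha t *+ m) y /\ forall T', t \in T' -> T' :\ t = T ->
      loc_map (gpr T') (g t) y = g t ^+ m *: z T'.
  have [tT|tT] := boolP (t \in T).
    exists 0%N => m _; exists 0; split; first exact: (gloc_part0 (hom_gpr T)).
    by move=> T' _ e; rewrite -e !inE eqxx in tT.
  have eT : gpr (t |: T) = gpr T * g t by rewrite (@gpr_D1 _ t) ?finset.setU11 // finset.setU1K.
  have [m0 h] := gloc_lift (hom_gpr T) eT (@hg t) (hz (t |: T)).
  exists m0 => m le; have [y hy ey] := h m le; exists y; split=> // T' tT' e.
  by have -> : T' = t |: T by rewrite -e finset.setD1K.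
have [m0 {}lift] := fin_all_exists lift.
pose m := \max_T m0 T.
have [y0 hy0] : exists y0 : forall T, loc V (gpr T), forall T,
    gloc_part (c + alpha t *+ m) (y0 T) /\ forall T', t \in T' -> T' :\ t = T ->
      loc_map (gpr T') (g t) (y0 T) = g t ^+ m *: z T'.
  exact: (fin_all_exists (fun T => lift T m (@leq_bigmax _ m0 T))).
(* As [y] is 0 on faces containing [t], its differential at such a face [T] reduces to the term of
   [T :\ t]; the sign makes it [g t ^+ m *: z T]. *)
pose y : cechsum := dprod_of (fun T => if t \in T then 0 else csign t T *: y0 T).
have hX j : hom (alpha t *+ j) (g t ^+ j).
  exact: (homX gr).
have hs T : hom 0 (csign t T).
  rewrite /csign -[0](mul0rn _ #|[pred s in T | (s < t)%N]|).
  apply: (homX gr).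
  exact/(homN gr)/(hom1 gr).
have hy : cech_part (alpha t *+ m + c) y.
  move=> T; rewrite ffunE addrC; case: ifP => _; first exact: (gloc_part0 (hom_gpr T)).
  rewrite -[_ + _]add0r; apply: (gloc_partZ (hom_gpr T)) => //.
  by case: (hy0 T).
pose e := cechdif y - g t ^+ m *: z.
have eT T : t \in T -> e T = 0.
  move=> tT; rewrite /e dprodD dprodN dprodZ cechdifE (bigD1 t) //= big1.
    rewrite addr0 ffunE !inE eqxx /= (loc_mapZ (gpr_D1 tT)) scalerA.
    case: (hy0 (T :\ t)) => _ /(_ T tT erefl) ->.
    suff -> : csign t T * csign t (T :\ t) = 1 by rewrite scale1r subrr.
    rewrite (_ : csign t (T :\ t) = csign t T); first by rewrite /csign -expr2 sqrr_sign.
    congr (_ ^+ _); apply: eq_card => i.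
    by rewrite !inE; case: eqVneq => // -> /=; rewrite ltnn andbF.
  move=> s /andP[sT ne]; rewrite ffunE !inE eq_sym ne tT /=.
  by rewrite (loc_map0 _ (gpr_D1 sT)) scaler0.
have de : cechdif e = 0.
  rewrite /e addrC -scaleN1r scalerA cechdif_linear dz scaler0 add0r.
  exact: cechdif2.
(* At [t |: T] the equation [cechdif e = 0] retains only the component at [T], which hence dies
   after inverting [g t]. *)
have kill T : exists N, g t ^+ N *: e T = 0.
  have [tT|tT] := boolP (t \in T); first by exists 0%N; rewrite eT // scaler0.
  suff h T' : t \in T' -> exists N, g t ^+ N *: e (T' :\ t) = 0.
    by have := h (t |: T); rewrite finset.setU1K // => /(_ (finset.setU11 _ _)).
  move=> tT'; apply: (loc_map_eq0 (gpr_D1 tT')).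
  have := congr1 (fun u : cechsum => u T') de; rewrite dprod0 cechdifE (bigD1 t) //= big1.
    rewrite addr0 => /(congr1 (fun u => csign t T' *: u)); rewrite scaler0 scalerA.
    by rewrite /csign -expr2 sqrr_sign scale1r.
  move=> s /andP[sT ne]; rewrite eT ?(loc_map0 _ (gpr_D1 sT)) ?scaler0 //.
  by rewrite !inE eq_sym ne.
have [N {}kill] := fin_all_exists kill.
pose N0 := \max_T N T.
have ke : g t ^+ N0 *: e = 0.
  apply/ffunP => T; rewrite dprodZ dprod0.
  have le : (N T <= N0)%N by exact: leq_bigmax.
  by rewrite -(subnK le) exprD -scalerA kill scaler0.
exists (N0 + m)%N, (g t ^+ N0 *: y); split.
  by rewrite mulrnDr -addrA; exact: (cech_partZ (hX _)).
apply/vanishing_setT => /=.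
have -> : cechdif (g t ^+ N0 *: y) = g t ^+ N0 *: cechdif y.
  by rewrite -[X in cechdif X]addr0 cechdif_linear -[0](cechdif2 0) !cechdif2 addr0.
by rewrite exprD -scalerA -scalerBr -opprB -/e scalerN ke oppr0.
Qed.

(** * Removing the nonempty faces under the Koszul complex *)

Section Koszul.
Variables (I : eqType) (x : I -> R) (e : I -> D) (s : seq I).
Hypothesis hx : forall i, hom (e i) (x i).
Hypothesis g_vars : forall t, exists2 q : I -> R,
  forall i, hom (alpha t - e i) (q i) & g t = \sum_(i <- s) q i * x i.

Local Notation kos := (koszul x e s).

(** The kernel of the map from [cechquot E] to [cechquot (E :\ T0)]: modulo [Z], only the component
    at [T0] is left. *)
Definition cechlayer E T0 : reldiff R D :=
  subrel (cechquot E) (vanishing (E :\ T0)) (vanishing E).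

Lemma cechlayerP E T0 : down_closed E -> down_closed (E :\ T0) ->
  reldiffP hom (cechlayer E T0).
Proof.
move=> dE dE'; split; [exact: cechdif_linear|exact: vanishing0|exact: vanishingB|
  exact: vanishingZ| | |exact: vanishing0|exact: vanishingB|exact: vanishingZ| |].
- by move=> c u; exact: vanishing_dif.
- by move=> c u [hu u0]; split=> // T; rewrite inE => /andP[_]; exact: u0.
- by move=> c u; exact: vanishing_dif.
- by move=> c u _ /=; rewrite cechdif2; exact: vanishing0.
Qed.

(* A layer is the localization at [gpr T0], on which [gpr T0], an element of the
   ideal generated by the [x i], acts bijectively. *)
Lemma cechlayer_acyclic E T0 : down_closed E -> down_closed (E :\ T0) ->
  T0 != finset.set0 -> forall c, acyclic (kos (cechlayer E T0)) c.
Proof.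
move=> dE dE' T0n c.
have [t tT0] : exists t, t \in T0 by apply/set0Pn.
have h0 := hom_gpr T0.
apply: (koszul_bijmul_acyclic gr hx (cechlayerP dE dE') h0) => {c}.
- split=> c u /= [hu u0].
    move=> [_ fu]; split=> // T TE; have [eT|ne] := eqVneq T T0; last first.
      by apply: u0; rewrite !inE ne.
    apply: (@scale_loc_inj _ _ (gpr T) _ 1); rewrite expr1.
    by have := fu T TE; rewrite dprodZ eT.
  have [v0 hv0 ev0] := gloc_divide h0 (hu T0).
  pose v : cechsum := dprod_of (dfwith (fun T => 0 : loc V (gpr T)) v0).
  have vE T : v T = dfwith (fun T => 0 : loc V (gpr T)) v0 T by rewrite ffunE.
  have hv : cech_part c v.
    by move=> T; rewrite vE; case: dfwithP => // T' _; exact: (gloc_part0 (hom_gpr _)).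
  exists v; first by split=> // T; rewrite !inE vE eq_sym => /andP[ne _]; rewrite dfwith_out.
  split=> [|T TE]; first by apply: cech_partB => //; exact: cech_partZ.
  rewrite dprodD dprodN dprodZ vE; case: dfwithP TE => [_|T' ne TE].
    by rewrite ev0 subrr.
  by rewrite scaler0 subr0 u0 // !inE eq_sym ne.
- have [q hq eg] := g_vars t; exists (fun i => gpr (T0 :\ t) * q i); split.
    move=> i; rewrite (_ : galpha T0 = galpha (T0 :\ t) + alpha t).
      by rewrite -addrA; apply: (homM gr) => //; exact: hom_gpr.
    by rewrite /galpha (big_setD1 t tT0) addrC.
  by rewrite (gpr_D1 tT0) eg mulr_sumr; apply: eq_bigr => i _; rewrite mulrA.
Qed.

(** The three complexes share carrier and differential, so both maps of the exact sequence are the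
    identity. *)
Lemma koszul_cech_step E T0 c : down_closed E -> down_closed (E :\ T0) ->
  T0 != finset.set0 ->
  acyclic (kos (cechquot E)) c <-> acyclic (kos (cechquot (E :\ T0))) c.
Proof.
move=> dE dE' nT0; have okU := cechlayerP dE dE'.
have okV := cechquotP dE; have okW := cechquotP dE'.
apply: (short_exact_acyclic (hom := hom) (U := kos (cechlayer E T0)));
  try exact: koszulP; last exact: cechlayer_acyclic.
apply: (koszul_short_exact (hom := hom)) => //.
have sub a u : vanishing E a u -> vanishing (E :\ T0) a u.
  by move=> [hu u0]; split=> // T; rewrite inE => /andP[_]; exact: u0.
exists id, id; split; [by []|by []| | |split].
- by move=> a u [hu u0]; split=> //=; rewrite subrr; exact: vanishing0.
- by move=> a u hu; split=> //=; rewrite subrr; exact: vanishing0.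
- by [].
- exact: sub.
- by [].
- by move=> a u hu zu; exists u => //=; rewrite subrr; exact: vanishing0.
- by move=> a u hu; exists u => //=; rewrite subrr; exact: vanishing0.
Qed.

(** Nonempty faces are removed one at a time, a largest one first, so that the remaining set stays
    down-closed. *)
Lemma koszul_cech_augmentation c :
  acyclic (kos (cechquot [set: {set 'I_r}]%SET)) c <->
  acyclic (kos (cechquot [set finset.set0]%SET)) c.
Proof.
have : finset.set0 \in [set: {set 'I_r}]%SET by rewrite inE.
move: down_closed_setT; move: [set: {set 'I_r}]%SET => E.
have [m] := ubnP #|E|; elim: m E => // m IH E; rewrite ltnS => leE dE E0.
have [->//|ne] := eqVneq E [set finset.set0]%SET.
have [T1 T1E T1n] : exists2 T1, T1 \in E & T1 != finset.set0.
  apply: contrapT => none; case/eqP: ne; apply/setP => T; rewrite inE.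
  apply/idP/eqP => [TE|-> //]; apply/eqP/negPn/negP => nT; apply: none.
  by exists T.
case: (arg_maxnP (fun T => #|T|) T1E) => T0 /= T0E max; have {}T0E : T0 \in E by [].
have T0n : T0 != finset.set0.
  by rewrite -card_gt0 (leq_trans _ (max _ T1E)) // card_gt0.
have dE' : down_closed (E :\ T0).
  move=> T t; rewrite !inE => /andP[_ TE] tT; rewrite dE // andbT.
  apply: contraTneq (max _ TE) => <-.
  by rewrite -ltnNge /= [X in (_ < X)%N](cardsD1 t) tT.
rewrite (koszul_cech_step _ dE dE' T0n); apply: IH => //.
  by apply: leq_trans leE; rewrite [X in (_ < X)%N](cardsD1 T0) T0E.
by rewrite !inE E0 eq_sym T0n.
Qed.

End Koszul.
End Cech.
End GradedLocalization.

(** * Supports of homology and the grading of a localization *)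

Section GradedFacts.
Context (S : comNzRingType) (k : nat) (n : 'I_k -> nat).
Local Notation R := (polyring S n).
Local Notation Zk := 'rV[int]_k.
Local Notation pgr := (@pregraded S k n).
Local Notation hom := (@polycomp S k n).

Lemma polycomp_uniq (a b : Zk) (f : R) : hom a f -> hom b f -> f <> 0 -> a = b.
Proof.
move=> ha hb /eqP; rewrite -msupp_eq0; case E: (msupp f) => [//|m0 s] _.
by rewrite -(ha m0) ?E ?mem_head // -(hb m0) ?E ?mem_head.
Qed.

Lemma polycomp_gradation : gradation hom.
Proof.
split; [exact: polycomp0|exact: polycomp1|exact: polycompD|exact: polycompN|
  exact: polycompM|exact: polycomp_uniq].
Qed.
Local Notation gr := polycomp_gradation.

Lemma gcomp_graded_part (M : pgr) : is_graded M -> graded_part hom (@gcomp _ _ _ M).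
Proof. by move=> gM; split; [exact: gcomp0|exact: gcompB|exact: gcompZ]. Qed.

Lemma submodule_val_linear (R' : comNzRingType) (V : lmodType R') (A : set V) a
    (x y : submodule A) :
  submodule_val (a *: x + y) = a *: submodule_val x + submodule_val y.
Proof. exact: (linearP (\val : {linear submodule A -> V})). Qed.

Definition is_submodule (R' : comNzRingType) (V : lmodType R') (A : set V) :=
  A 0 /\ forall a x y, A x -> A y -> A (a *: x + y).

Lemma is_submodule_span (R' : comNzRingType) (V : lmodType R') (A : set V) x :
  is_submodule A -> span A x -> A x.
Proof. by case=> A0 AD; apply: span_min. Qed.

(** Membership in [Bd] ignores degrees, whereas [acyclic] asks for a homogeneous primitive; the gap
    is closed later by projecting to the degree. *)
Lemma Supp_homology (V : pgr) (Z Bd : set V) (a : Zk) :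
  is_submodule Z -> is_submodule Bd ->
  Supp (homology Z Bd) a <-> exists x, [/\ gcomp a x, Z x & ~ Bd x].
Proof.
move=> sZ [B0 BD]; have sB : is_submodule [set z : submodule Z | Bd (submodule_val z)].
  split=> [|q x y] /=; last first.
    by move=> Bx By; have := BD q _ _ Bx By; rewrite -submodule_val_linear.
  suff e : submodule_val (0 : submodule Z) = 0 by exact: (eq_ind_r Bd B0 e).
  by have := @submodule_val_linear _ _ Z (-1) 0 0; rewrite !scaleN1r !addNr.
split=> [[_ [z hz <-] nz]|[x [hx Zx nB]]].
  exists (submodule_val z); split=> //.
    by apply: (is_submodule_span sZ); exact/asboolP/(valP z).
  by move=> Bz; apply: nz; rewrite -(linear0 (@qpi _ _ _)); apply/qpi_eq; rewrite subr0;
    exact: mem_span.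
have px : spanb Z x by apply/asboolP/mem_span.
exists (qpi _ (Submodule px)); first by exists (Submodule px).
rewrite -(linear0 (@qpi _ _ _)) => /qpi_eq; rewrite subr0.
by move=> /(is_submodule_span sB).
Qed.

(** Directness is inherited from [M] by passing to a common denominator [f ^+ m] and killing the sum
    of the numerators by [f ^+ N]. *)
Lemma gloc_graded (M : pgr) (gM : is_graded M) (f : R) (b : Zk) :
  hom b f -> is_graded (gloc M f).
Proof.
move=> hf; have gp := gcomp_graded_part gM.
have numer := gloc_numer gr gp hf.
have hX N : hom (b *+ N) (f ^+ N) by exact: (homX gr).
split.
- exact: (gloc_part0 gr gp hf).
- by move=> a x y; exact: (gloc_partB gr gp hf).
- by move=> a c q x; exact: (gloc_partZ gr gp hf).
- move=> u; have [x [m ->]] := frac_ex u; have [s [c [hc ->]]] := gcomp_sum gM x.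
  exists [seq a - b *+ m | a <- s], (fun a => frac f (c (a + b *+ m)) m); split.
    by move=> a; exists b, m, (c (a + b *+ m)).
  rewrite big_map; under eq_bigr do rewrite subrK.
  elim: (s) => [|a s' IH]; first by rewrite !big_nil frac0.
  by rewrite !big_cons -IH fracD.
- move=> s c us hc sum0 a as_.
  have [m0 h] := choice (fun a => numer a (c a) (hc a)).
  pose m := \max_(a <- s) m0 a.
  have [x hx] : exists x : Zk -> M, forall a, a \in s ->
      gcomp (a + b *+ m) (x a) /\ c a = frac f (x a) m.
    pose P a0 y := a0 \in s -> gcomp (a0 + b *+ m) y /\ c a0 = frac f y m.
    suff: forall a0, exists y, P a0 y by move/choice=> [x hx]; exists x => a0; exact: hx.
    move=> a0; rewrite /P; have [a0s|] := boolP (a0 \in s); last by exists 0.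
    by have [y hy ey] := h a0 m (leq_bigmax_seq _ a0s isT); exists y.
  rewrite (eq_big_seq (fun a => frac f (x a) m)) in sum0; last by move=> a0 /hx[].
  have fs : \sum_(a <- s) frac f (x a) m = frac f (\sum_(a <- s) x a) m.
    elim: (s) => [|a0 s' IH]; first by rewrite !big_nil frac0.
    by rewrite !big_cons IH fracD.
  rewrite fs in sum0; have [N eN] := (frac_eq0 _ _ _).1 sum0.
  have [_ ->] := hx _ as_; apply/frac_eq0; exists N.
  (* The numerator of index [a], multiplied by [f ^+ N], has degree [a + b *+ m + b *+ N]; [c']
     reindexes by that degree. *)
  pose c' a1 : M := if a1 - b *+ N - b *+ m \in s then f ^+ N *: x (a1 - b *+ N - b *+ m) else 0.
  have e1 a1 : a1 + b *+ m + b *+ N - b *+ N - b *+ m = a1 by rewrite !addrK.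
  have := @gcomp_direct _ _ _ _ gM [seq a + b *+ m + b *+ N | a <- s] c'.
  rewrite map_inj_uniq; last by move=> a1 a2 /addIr/addIr.
  move=> /(_ us) h1; have hc' a1 : gcomp a1 (c' a1).
    rewrite /c'; case: ifP => [a1s|_]; last exact: (gcomp0 gM).
    have := gcompZ gM (hX N) (hx _ a1s).1.
    by rewrite subrK addrC subrK.
  have sum0' : \sum_(a1 <- [seq a + b *+ m + b *+ N | a <- s]) c' a1 = 0.
    rewrite big_map -[RHS]eN scaler_sumr; apply: eq_big_seq => a1 a1s.
    by rewrite /c' e1 a1s.
  have := h1 hc' sum0' (a + b *+ m + b *+ N).
  by rewrite /c' e1 as_; apply; apply/mapP; exists a.
Qed.

End GradedFacts.

(** * The total Cech complex and local cohomology *)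

Section CechHomology.
Context (S : comNzRingType) (k : nat) (n : 'I_k -> nat).
Local Notation R := (polyring S n).
Local Notation Zk := 'rV[int]_k.
Local Notation pgr := (@pregraded S k n).
Local Notation hom := (@polycomp S k n).
Local Notation gr := (@polycomp_gradation S k n).
Variables (M : pgr) (gM : is_graded M).
Variables (r : nat) (g : 'I_r -> R) (alpha : 'I_r -> Zk).
Hypothesis hg : forall t, hom (alpha t) (g t).
Local Notation gp := (gcomp_graded_part gM).
Local Notation cs := (cechsum M g).
Local Notation cpart := (cech_part hom (@gcomp _ _ _ M)).

Lemma gloc_gprod_graded T : is_graded (gloc M (gpr g T)).
Proof. exact: (@gloc_graded S k n M gM (gpr g T) (galpha alpha T) (hom_gpr gr hg T)). Qed.

Definition cech_restrict p (u : cs) : cech g M p :=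
  dprod_of (fun T : face r p => u (val T)).

Definition cech_extend p (c : cech g M p) : cs :=
  dprod_of (fun T : {set 'I_r} => match pselect (#|T| == p) return loc M (gpr g T) with
    | left h => c (exist _ T h)
    | right _ => 0 end).

Lemma cech_restrictE p u T : cech_restrict p u T = u (val T).
Proof. exact: ffunE. Qed.

Lemma cech_extendK p c : cech_restrict p (cech_extend c) = c.
Proof.
apply/ffunP => -[T hT]; rewrite cech_restrictE ffunE /=.
by case: pselect => [h|//]; rewrite (eq_irrelevance h hT).
Qed.

Lemma cech_extend_other p q (c : cech g M p) : p != q ->
  cech_restrict q (cech_extend c) = 0.
Proof.
move=> ne; apply/ffunP => -[T hT]; rewrite cech_restrictE ffunE /= dprod0.
by case: pselect => // h; rewrite -(eqP h) -(eqP hT) eqxx in ne.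
Qed.

Lemma cech_restrict_linear p : linear (cech_restrict p).
Proof.
by move=> a u v; apply/ffunP => T; rewrite dprodD dprodZ !cech_restrictE dprodD dprodZ.
Qed.

Lemma cech_restrict_eq0 u : (forall p, cech_restrict p u = 0) -> u = 0.
Proof.
move=> h; apply/ffunP => T.
have := congr1 (fun c : cech g M #|T| => c (exist _ T (eqxx _))) (h #|T|).
by rewrite cech_restrictE !dprod0.
Qed.

Lemma cech_restrict_dif p u : cech_restrict p.+1 (cechdif u) = cech_d (cech_restrict p u).
Proof.
apply/ffunP => T; rewrite cech_restrictE cechdifE [RHS]ffunE; apply: eq_bigr => t tT.
case: insubP => [T' _ eT'|].
  by rewrite cech_restrictE eT'.
by move/negP=> []; have := eqP (valP T); rewrite (cardsD1 t) tT add1n => -[->].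
Qed.

Lemma cech_restrict_dif0 u : cech_restrict 0 (cechdif u) = 0.
Proof.
apply/ffunP => T; rewrite cech_restrictE cechdifE dprod0 big1 // => t.
by have := valP T; rewrite cards_eq0 => /eqP ->; rewrite inE.
Qed.

Lemma cech_d_linear p : linear (@cech_d S k n r g M p).
Proof.
move=> a x y; rewrite -(cech_extendK x) -(cech_extendK y).
rewrite -cech_restrict_linear -!cech_restrict_dif cechdif_linear.
exact: cech_restrict_linear.
Qed.

Lemma cech_d0 p : cech_d (0 : cech g M p) = 0.
Proof.
have := cech_d_linear (-1) (0 : cech g M p) 0.
by rewrite !scaleN1r !addNr.
Qed.

(** The differential has degree 0, so each component of [w] may be replaced by its part of degree
    [a]. *)
Lemma cechdif_proj a (u w : cs) : cpart a u -> u = cechdif w ->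
  exists2 w', cpart a w' & u = cechdif w'.
Proof.
move=> hu eu.
pose w' : cs := dprod_of (fun T => @proj S k n (gloc M (gpr g T)) a (w T)).
have w'E T : w' T = @proj S k n (gloc M (gpr g T)) a (w T) by exact: ffunE.
exists w' => [T|]; first by rewrite w'E; exact: (gcomp_proj (gloc_gprod_graded T)).
apply/ffunP => T; rewrite cechdifE.
rewrite -[LHS](proj_id (gloc_gprod_graded T) (hu T)) eu cechdifE.
rewrite (proj_sum (gloc_gprod_graded T)); apply: eq_bigr => t tT.
have hs : hom 0 (csign R t T).
  rewrite /csign -[0](mul0rn _ #|[pred s in T | (s < t)%N]|).
  by apply: (homX gr); exact/polycompN/polycomp1.
rewrite -[X in proj X _](add0r a) (projZ (gloc_gprod_graded T) _ _ hs) w'E.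
congr (_ *: _); apply: (proj_degree0 (gloc_gprod_graded _) (gloc_gprod_graded _)).
  exact: loc_map_linear (gpr_D1 g tT).
move=> c x; exact: (gloc_map gr gp (hom_gpr gr hg (T :\ t)) (gpr_D1 g tT) (@hg t)).
Qed.

(** The differential raises the size of faces by one, so cycles and boundaries of the total complex
    split by size. *)
Lemma cech_acyclicP a : acyclic (cechquot hom (@gcomp _ _ _ M) g [set: {set 'I_r}]%SET) a
  <-> forall p, ~ Supp (local_cohomology g M p) a.
Proof.
have suppP p : Supp (local_cohomology g M p) a <->
    exists c, [/\ gcomp a c, cech_d c = 0 & ~ @cech_coboundaries _ _ _ _ g M p c].
  apply: Supp_homology.
    split=> [|q x y] /=; first exact: cech_d0.
    by rewrite /cech_cocycles /= cech_d_linear => -> ->; rewrite scaler0 addr0.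
  case: p => [|p].
    by split=> //= q x y -> ->; rewrite scaler0 addr0.
  split=> [|q _ _ [x _ <-] [y _ <-]]; first by exists 0 => //; exact: cech_d0.
  by exists (q *: x + y) => //; exact: cech_d_linear.
split=> [ac p /suppP[c [hc dc nB]]|nS u hu /(vanishing_setT gr gp hg) du].
- pose u := cech_extend c.
  have hu : cpart a u.
    move=> T; rewrite ffunE; case: pselect => [h|_]; first exact: (hc (exist _ T h)).
    exact: (gloc_part0 gr gp (hom_gpr gr hg T)).
  have du : cechdif u = 0.
    apply: cech_restrict_eq0 => -[|q]; first exact: cech_restrict_dif0.
    rewrite cech_restrict_dif; have [->|ne] := eqVneq q p; first by rewrite cech_extendK.
    by rewrite cech_extend_other 1?eq_sym // cech_d0.
  have [|w _ /(vanishing_setT gr gp hg) e0] := ac u hu.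
    by rewrite /= du; exact: (vanishing0 gr gp hg).
  move/eqP: e0; rewrite subr_eq0 => /eqP /= eu; apply: nB; rewrite -(cech_extendK c) -/u eu.
  case: (p) => [|q]; first exact: cech_restrict_dif0.
  by rewrite cech_restrict_dif; exists (cech_restrict q w).
- have {}du : cechdif u = 0 by exact: du.
  have ex p : exists w : cech g M p, cech_restrict p.+1 u = cech_d w.
    apply: contrapT => none; apply: (nS p.+1); apply/suppP; exists (cech_restrict p.+1 u).
    split=> [T||[w _ e]]; first by rewrite cech_restrictE; exact: hu.
      rewrite -cech_restrict_dif du; apply/ffunP => T.
      by rewrite cech_restrictE !dprod0.
    by apply: none; exists w.
  (* In size 0 the only coboundary is 0, so this component of the cycle vanishes outright. *)
  have r0 : cech_restrict 0 u = 0.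
    apply: contrapT => nz; apply: (nS 0%N); apply/suppP; exists (cech_restrict 0 u).
    split=> // [T|]; first by rewrite cech_restrictE; exact: hu.
    rewrite -cech_restrict_dif du; apply/ffunP => T.
    by rewrite cech_restrictE !dprod0.
  have [w hw] : exists w : forall p, cech g M p,
      forall p, cech_restrict p.+1 u = cech_d (w p).
    by exists (fun p => projT1 (cid (ex p))) => p; case: (cid (ex p)).
  pose W : cs := dprod_of (fun T : {set 'I_r} => w #|T| (exist _ T (eqxx _))).
  have rW p : cech_restrict p W = w p.
    apply/ffunP => -[T hT]; rewrite cech_restrictE ffunE /=.
    have e := eqP hT; subst p; congr (w _ (exist _ _ _)); exact: eq_irrelevance.
  have eu : u = cechdif W.
    apply/eqP; rewrite -subr_eq0; apply/eqP/cech_restrict_eq0 => p.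
    rewrite addrC -scaleN1r cech_restrict_linear scaleN1r addrC; apply/eqP; rewrite subr_eq0.
    apply/eqP; case: p => [|p]; first by rewrite r0 cech_restrict_dif0.
    by rewrite cech_restrict_dif rW hw.
  have [w' hw' ew'] := cechdif_proj hu eu.
  exists w' => //=; rewrite -ew' subrr; exact: (vanishing0 gr gp hg).
Qed.

End CechHomology.

(** * Products of a sequence of modules *)

Section Product.
Context (R : comNzRingType) (V : nat -> lmodType R).

(** A resolution may have infinite length; sequences without a finiteness condition suffice, as the
    differential and the degree conditions are tested index by index. *)
Definition seqprod : Type := forall j, V j.

HB.instance Definition _ := gen_eqMixin seqprod.
HB.instance Definition _ := gen_choiceMixin seqprod.

Implicit Types x y z : seqprod.
Definition sadd x y : seqprod := fun j => x j + y j.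
Definition sopp x : seqprod := fun j => - x j.
Definition szero : seqprod := fun j => 0.
Definition sscale (a : R) x : seqprod := fun j => a *: x j.

Fact saddA : associative sadd.
Proof. by move=> x y z; apply: functional_extensionality_dep => j; rewrite /sadd addrA. Qed.
Fact saddC : commutative sadd.
Proof. by move=> x y; apply: functional_extensionality_dep => j; rewrite /sadd addrC. Qed.
Fact sadd0 : left_id szero sadd.
Proof. by move=> x; apply: functional_extensionality_dep => j; rewrite /sadd add0r. Qed.
Fact saddN : left_inverse szero sopp sadd.
Proof. by move=> x; apply: functional_extensionality_dep => j; rewrite /sadd addNr. Qed.

HB.instance Definition _ := GRing.isZmodule.Build seqprod saddA saddC sadd0 saddN.

Fact sscaleA a b x : sscale a (sscale b x) = sscale (a * b) x.
Proof. by apply: functional_extensionality_dep => j; rewrite /sscale scalerA. Qed.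
Fact sscale1 : left_id 1 sscale.
Proof. by move=> x; apply: functional_extensionality_dep => j; rewrite /sscale scale1r. Qed.
Fact sscaleDr : right_distributive sscale +%R.
Proof. by move=> a x y; apply: functional_extensionality_dep => j; rewrite /sscale scalerDr. Qed.
Fact sscaleDl x : {morph sscale^~ x : a b / a + b}.
Proof. by move=> a b; apply: functional_extensionality_dep => j; rewrite /sscale scalerDl. Qed.

HB.instance Definition _ := GRing.Zmodule_isLmodule.Build R seqprod
  sscaleA sscale1 sscaleDr sscaleDl.

Lemma seqprodD x y j : (x + y) j = x j + y j. Proof. by []. Qed.
Lemma seqprodN x j : (- x) j = - x j. Proof. by []. Qed.
Lemma seqprodZ a x j : (a *: x) j = a *: x j. Proof. by []. Qed.
End Product.

(** * The total complex of a free resolution *)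

Section Resolution.
Context (S : comNzRingType) (k : nat) (n : 'I_k -> nat).
Local Notation R := (polyring S n).
Local Notation Zk := 'rV[int]_k.
Local Notation pgr := (@pregraded S k n).
Local Notation hom := (@polycomp S k n).
Local Notation gr := (@polycomp_gradation S k n).
Local Notation kos s := (koszul (@var S k n) (@vdeg k n) s).
Variables (M : gradedmod S n) (F : gfree_resolution M).

Let gF j : is_graded (F j) := gmodP (F j).
Let gM : is_graded M := gmodP M.

Definition resprod := seqprod (fun j => F j : lmodType R).
HB.instance Definition _ := GRing.Lmodule.on resprod.

Definition resdif (u : resprod) : resprod := fun j => res_d F j (u j.+1).

(* [t] lists the variables already divided out, and [b] is a degree shift *)
Definition rescomplex (t : seq (vars n)) (b : Zk) : reldiff R Zk :=
  Reldiff resdif (fun a => [set u | forall j, gcomp (b + a) (u j)])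
    (fun a => [set u | forall j, gvarmul (F j) t (b + a) (u j)]).

Lemma resdif_linear : linear resdif.
Proof.
by move=> q u v; apply: functional_extensionality_dep => j; rewrite /resdif linearP.
Qed.

Lemma resdif2 u : resdif (resdif u) = 0.
Proof.
apply: functional_extensionality_dep => j; rewrite /resdif.
by apply/res_exact; exists (u j.+2).
Qed.

Lemma rescomplexP t b : reldiffP hom (rescomplex t b).
Proof.
split=> /=.
- exact: resdif_linear.
- by move=> a j; exact: (gcomp0 (gF j)).
- by move=> a u v hu hv j; exact: (gcompB (gF j)).
- by move=> a c q u hq hu j; rewrite addrCA; exact: (gcompZ (gF j)).
- by move=> a u hu j; exact: res_d_degree0.
- by move=> a u hu j; exact: (gvarmul_gcomp (gF j) (hu j)).
- by move=> a j; exact: (gvarmul0 (gF j)).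
- by move=> a u v hu hv j; exact: (gvarmulB (gF j)).
- by move=> a c q u hq hu j; rewrite addrCA; exact: (gvarmulZ (gF j)).
- move=> a u hu j; apply: (@gvarmul_degree0 S k n (F j.+1) (F j) (res_d F j)) => //.
  exact: res_d_degree0.
- by move=> a u _ j; rewrite resdif2; exact: (gvarmul0 (gF j)).
Qed.

(* Dividing by a variable that is regular modulo the preceding ones is the same
   as taking a cone. *)
Lemma koszul_rescomplex_step v s t b a : v \notin t ->
  acyclic (kos (v :: s) (rescomplex t b)) a <->
  acyclic (kos s (rescomplex (v :: t) (vdeg v + b))) a.
Proof.
move=> vt; set C := mulcone (var S v) (vdeg v) (rescomplex t b).
set W := rescomplex (v :: t) (vdeg v + b).
(* The kernel of the second projection from the cone to [W]: second coordinates in the submodule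
   generated by [v :: t]. *)
pose U : reldiff R Zk := @subrel _ _ C
  (fun a => [set p | gpart C a p /\ zpart W a p.2]) (zpart C).
have hv := @polycomp_var S k n v.
have okC : reldiffP hom C by exact: (mulconeP hv (rescomplexP _ _)).
have okW : reldiffP hom W := rescomplexP _ _.
have degE c : vdeg v + b + c - vdeg v = b + c :> Zk.
  by zmod_eq.
have degE2 c : b + (vdeg v + c) = vdeg v + b + c :> Zk by rewrite addrCA addrA.
have zsub c p : zpart C c p -> zpart W c p.2.
  move=> [_ z2] j; exists (p.2 j), 0; rewrite scaler0 addr0; split=> //.
    by have := z2 j; rewrite degE2.
  exact: (gcomp0 (gF j)).
have xW c (u : resprod) : (forall j, gcomp (b + c) (u j)) ->
    zpart W c (var S v *: u).
  by move=> hu j; apply: (gvarmul_var (gF j)); rewrite ?mem_head // degE.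
have okU : reldiffP hom U.
  split=> /=; [exact: (difP okC)| | | | | |exact: (zpart0 okC)|exact: (zpartB okC)|
    exact: (zpartZ okC)|exact: (zpart_dif okC)| ].
  - by move=> c; split; [exact: (gpart0 okC)|exact: (zpart0 okW)].
  - by move=> c p q [? ?] [? ?]; split; [exact: (gpartB okC)|exact: (zpartB okW)].
  - by move=> c d q p hq [? ?]; split; [exact: (gpartZ okC)|exact: (zpartZ okW)].
  - move=> c p [gp zp]; split; first exact: (gpart_dif okC).
    by apply: (zpartD okW); [apply: xW; case: gp|exact: (zpart_dif okW)].
  - by move=> c p zp; split; [exact: (zpart_sub okC)|exact: zsub].
  - by move=> c p [gp _]; exact: (dif2 okC).
rewrite /=; apply: (koszul_quasi_iso (hom := hom) _ _ _ okU okC okW) => {a s}.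
- by move=> i; exact: polycomp_var.
- exists id, snd; split; [by []|by []| | |split].
  + by move=> a p [gp zp]; split=> //; rewrite [X in zpart C a X]subrr; exact: (zpart0 okC).
  + move=> a p gp; split=> /=.
      by case: gp => _ g2 j; have := g2 j; rewrite degE2.
    by rewrite addrK; apply: xW; case: gp.
  + by [].
  + exact: zsub.
  + by move=> a p [_ zp].
  + by move=> a p gp zp; exists p => //; rewrite [X in zpart C a X]subrr; exact: (zpart0 okC).
  + move=> a w gw; exists (0, w) => /=; last by rewrite subrr; exact: (zpart0 okW).
    split=> j /=; first exact: (gcomp0 (gF j)).
    by rewrite degE2; exact: gw.
(* Write [w] as [var S v *: c] modulo the variables of [t]. The cycle condition makes
   [var S v *: (u + resdif c)] zero modulo [t], regularity removes the variable, and [(c, 0)] is the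
   primitive. *)
- move=> a [u w] [[/= gu gw] /= zw] [/= _ /= dw].
  have [c hc] : exists c : resprod, forall j,
      gcomp (b + a) (c j) /\ gvarmul (F j) t (vdeg v + b + a) (w j - var S v *: c j).
    have ex j : exists c, gcomp (b + a) c /\
        gvarmul (F j) t (vdeg v + b + a) (w j - var S v *: c).
      have [z [c [hz hc ->]]] := zw j; exists c; rewrite degE in hc.
      by rewrite addrK.
    by exists (fun j => projT1 (cid (ex j))) => j; case: (cid (ex j)).
  have cC : zpart (rescomplex t b) a (u + resdif c).
    move=> j; have gj : gcomp (b + a) ((u + resdif c) j).
      rewrite seqprodD; apply: (gcompD (gF j)); first exact: gu.
      by apply: res_d_degree0; case: (hc j.+1).
    apply/(gvarmulP (gF j) _ gj); apply: (free_var_regular (res_free F j) vt).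
    have -> : var S v *: (u + resdif c) j =
        (var S v *: u + resdif w) j - res_d F j (w j.+1 - var S v *: c j.+1).
      rewrite !seqprodD !seqprodZ scalerDr linearB linearZ /resdif /=; zmod_eq.
    apply: spanB; first by apply: gvarmul_span (dw j).
    apply: (@gvarmul_span S k n (F j) t (vdeg v + b + a)).
    apply: (@gvarmul_degree0 S k n (F j.+1) (F j) (res_d F j)); last by case: (hc j.+1).
    exact: res_d_degree0.
  exists (c, 0) => /=.
    split; last exact: (zpart0 okW).
    by split=> j /=; [case: (hc j)|exact: (gcomp0 (gF j))].
  split=> /=; first by rewrite opprK.
  move=> j; rewrite seqprodD seqprodN degE2 [X in gvarmul _ _ _ (_ - X)]seqprodD.
  by rewrite /resdif linear0 addr0; case: (hc j).
Qed.

(** Each variable divided out is put in front of [t] and adds its degree to the shift, whence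
    [catrev] and the sum. *)
Lemma koszul_rescomplex s t b a : uniq (s ++ t) ->
  acyclic (kos s (rescomplex t b)) a <->
  acyclic (rescomplex (catrev s t) (\sum_(v <- s) vdeg v + b)) a.
Proof.
elim: s t b => [|v s IH] t b us; first by rewrite big_nil add0r.
have vt : v \notin t.
  by move: us => /= /andP[]; rewrite mem_cat negb_or => /andP[].
rewrite koszul_rescomplex_step // IH /=.
  by rewrite big_cons -addrA addrCA.
by rewrite (perm_uniq (permEl (perm_catCA s [:: v] t))).
Qed.

(** * From the resolution to the module *)

Section Augmentation.
Variables (r : nat) (g : 'I_r -> R) (alpha : 'I_r -> Zk).
Hypothesis hg : forall t, hom (alpha t) (g t).
Local Notation gp := (gcomp_graded_part gM).
Local Notation cech0 := (cechquot hom (@gcomp _ _ _ M) g [set finset.set0]%SET).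

Lemma gpr0 : gpr g finset.set0 = 1.
Proof. by rewrite /gpr big_set0. Qed.

Lemma down_closed_set1 : down_closed [set (finset.set0 : {set 'I_r})]%SET.
Proof. by move=> T t; rewrite !inE => /eqP ->; rewrite inE. Qed.

Lemma cech0P : reldiffP hom cech0.
Proof. exact: (cechquotP gr gp hg down_closed_set1). Qed.

Definition augment (u : resprod) : cechsum M g :=
  dprod_of (fun T : {set 'I_r} =>
    frac (gpr g T) (if T == finset.set0 then res_aug F (u 0%N) else 0) 0).

Lemma augmentE u T : augment u T =
  frac (gpr g T) (if T == finset.set0 then res_aug F (u 0%N) else 0) 0.
Proof. exact: ffunE. Qed.

Lemma augment_linear : linear augment.
Proof.
move=> a u v; apply/ffunP => T; rewrite dprodD dprodZ !augmentE fracZ fracD.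
by case: ifP => _; rewrite ?linearP // scaler0 addr0.
Qed.

(** Modulo [Z], [cech0] is [M] itself; the augmentation maps onto it, with a kernel that is acyclic
    by exactness of the resolution. *)
Lemma koszul_augment s a : acyclic (kos s (rescomplex [::] 0)) a <->
  acyclic (kos s cech0) a.
Proof.
have okV := rescomplexP [::] 0; have okW := cech0P.
pose U := subrel (rescomplex [::] 0)
  (fun a => [set u : resprod | (forall j, gcomp a (u j)) /\ res_aug F (u 0%N) = 0])
  (fun a => [set 0]).
have okU : reldiffP hom U.
  split=> //=.
  - exact: resdif_linear.
  - by move=> c; split=> [j|]; rewrite ?linear0 //; exact: (gcomp0 (gF j)).
  - move=> c u v [hu u0] [hv v0]; split=> [j|]; first exact: (gcompB (gF j)).
    by rewrite seqprodD seqprodN linearB u0 v0 subrr.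
  - move=> c d q u hq [hu u0]; split=> [j|]; first exact: (gcompZ (gF j)).
    by rewrite seqprodZ linearZ_LR u0 scaler0.
  - move=> c u [hu u0]; split=> [j|]; first exact: res_d_degree0.
    by apply/res_exact0; exists (u 1%N).
  - move=> c u ->; split=> [j|]; rewrite ?linear0 //; exact: (gcomp0 (gF j)).
  - by move=> c u v -> ->; rewrite subr0.
  - by move=> c d q u _ ->; rewrite scaler0.
  - by move=> c u ->; apply: functional_extensionality_dep => j; rewrite /resdif linear0.
  - by move=> c u _; rewrite resdif2.
have zV c u : zpart (rescomplex [::] 0) c u <-> u = 0.
  split=> [h|-> //]; apply: functional_extensionality_dep => j; exact: h.
have zW c (u : cechsum M g) : cech_part hom (@gcomp _ _ _ M) c u -> u finset.set0 = 0 ->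
    zpart cech0 c u.
  by move=> hu u0; split=> // T; rewrite inE => /eqP ->.
have homaug c u : (forall j, gcomp c (u j)) ->
    cech_part hom (@gcomp _ _ _ M) c (augment u).
  move=> hu T; rewrite augmentE.
  apply/(gloc_partP gr gp _ _ (hom_gpr gr hg T)); exists 0%N; eexists.
  split; last reflexivity; rewrite mulr0n addr0.
  by case: ifP => _; [apply: res_aug_degree0; exact: hu|exact: (gcomp0 gM)].
have eq0 u : (augment u) finset.set0 = 0 <-> res_aug F (u 0%N) = 0.
  rewrite augmentE eqxx; split=> [/frac_eq0[N]|->]; last exact: frac0.
  by rewrite gpr0 expr1n scale1r.
apply: (koszul_quasi_iso (hom := hom) _ _ _ okU okV okW) => {a s}.
- by move=> i; exact: polycomp_var.
- exists id, augment; split; [by []|exact: augment_linear| | |split].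
  + move=> a u [hu _]; split; first by move=> j; rewrite add0r.
    by apply/zV; rewrite /= subrr.
  + move=> a u hu; have hu' j : gcomp a (u j) by have := hu j; rewrite add0r.
    split; first exact: homaug.
    apply: zW => /=.
      apply: (cech_partB gr gp hg); first by apply: homaug => j; exact: res_d_degree0.
      by apply: (cech_part_dif gr gp hg); exact: homaug.
    rewrite dprodD dprodN cechdifE big1 => [|t]; last by rewrite inE.
    rewrite subr0; apply/eq0; apply/res_exact0; by exists (u 1%N).
  + by move=> a u _; exact: zV.
  + move=> a u /zV ->; apply: zW; first by apply: homaug => j; exact: (gcomp0 (gF j)).
    by apply/eq0; rewrite linear0.
  + by move=> a u [hu u0]; apply: zW; [exact: homaug|apply/eq0].
  + move=> a u hu [_ /(_ finset.set0)]; rewrite inE eqxx => /(_ isT)/eq0 u0.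
    exists u; first by split=> // j; have := hu j; rewrite add0r.
    by apply/zV; rewrite subrr.
  + move=> a w hw.
    have /(gloc_partP gr gp _ _ (hom_gpr gr hg finset.set0))[m [x [hx ex]]] := hw finset.set0.
    rewrite /galpha big_set0 mul0rn addr0 in hx.
    have [y ey] := res_aug_surj F x.
    have hy : res_aug F (proj a y) = x.
      by rewrite -(proj_degree0 (gF 0) gM _ _ _ (@res_aug_degree0 _ _ _ _ F)) ?ey ?(proj_id gM) //;
        exact: linearP.
    pose u : resprod := dfwith (fun j => 0 : F j) (proj a y : F 0%N).
    have hu j : gcomp a (u j).
      rewrite /u; case: dfwithP => [|i _]; first exact: (gcomp_proj (gF 0)).
      exact: (gcomp0 (gF i)).
    exists u; first by move=> j; rewrite add0r.
    apply: zW; first by apply: (cech_partB gr gp hg) => //; exact: homaug.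
    rewrite dprodD dprodN augmentE eqxx ex /u dfwith_in hy; apply/eqP; rewrite subr_eq0.
    by apply/eqP/frac_eq; exists 0%N; rewrite gpr0 !expr1n.
- move=> a u [hu u0] du; have {}du : resdif u = 0 by exact: du.
  have ex j : exists v : F j.+1, gcomp a v /\ res_d F j v = u j.
    have [y ey] : exists y, res_d F j y = u j.
      case: j => [|j]; first exact/res_exact0.
      by apply/res_exact; have := congr1 (fun w : resprod => w j) du.
    exists (proj a y); split; first exact: (gcomp_proj (gF _)).
    rewrite -(proj_degree0 (gF _) (gF j) _ _ _ (@res_d_degree0 _ _ _ _ F j)); last exact: linearP.
    by rewrite ey (proj_id (gF j)).
  (* The primitive is shifted by one index; the value 0 at index 0 keeps it in the kernel of the
     augmentation. *)
  pose v : resprod := fun j => if j is j'.+1 return F j then projT1 (cid (ex j')) else 0.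
  have hv j : gcomp a (v j).
    by case: j => [|j] /=; [exact: (gcomp0 (gF 0))|case: (cid _) => ? []].
  have dv : resdif v = u.
    by apply: functional_extensionality_dep => j; rewrite /resdif /v; case: (cid _) => ? [].
  exists v => /=; last by rewrite dv subrr.
  by split=> //; exact: linear0.
Qed.

End Augmentation.

End Resolution.

(** * Tensoring with a cyclic module *)

Section TensorMap.
Context (R : comNzRingType) (V V' W : lmodType R) (f : {linear V -> V'}).

Lemma tensor_map_linear : linear (tensor_map f : tensor V W -> tensor V' W).
Proof.
move=> a u v; rewrite -[u]qpi_repr -[v]qpi_repr -linearP !tensor_mapE.
exact: fglift_linear.
Qed.

Lemma tensor_map0 : tensor_map f (0 : tensor V W) = 0.
Proof. by have := tensor_map_linear (-1) 0 0; rewrite !scaleN1r !addNr. Qed.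

End TensorMap.

Section CyclicTensor.
Context (R : comNzRingType) (V : lmodType R) (I : set R^o) (IV : set V).
Hypothesis mulIV : forall f x, I f -> span IV (f *: x).
Hypothesis IVE : forall y, IV y -> exists f x, I f /\ y = f *: x.
Local Notation W := (modquot I).
Local Notation one := (qpi I (1 : R^o)).

Lemma span_mulIV f x : span I f -> span IV ((f : R) *: x).
Proof.
move=> h; apply: (span_min (B := [set p : R^o | span IV ((p : R) *: x)]) _ _ _ h)
  => /= [|a p q hp hq|p]; last exact: mulIV.
  by rewrite scale0r; exact: span0.
by rewrite scalerDl -scalerA; apply: spanD => //; exact: spanZ.
Qed.

Lemma scale_one (f : R) : f *: one = qpi I (f : R^o).
Proof. by rewrite -linearZ_LR /GRing.scale /= mulr1. Qed.

Lemma qpi_one (y : W) : y = (repr y : R) *: one.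
Proof. by rewrite scale_one qpi_repr. Qed.

Lemma tens_cyclic (u : tensor V W) : exists x, u = tens x one.
Proof.
rewrite -[u]qpi_repr; move: (repr u) => t; rewrite -[t]freeg_sumE.
elim: (dom t) => [|z s [x IH]].
  rewrite big_nil; exists 0; rewrite -(scale0r (0 : V)) tensZl scale0r.
  exact: linear0.
exists (coeff z t *: ((repr z.2 : R) *: z.1) + x).
rewrite big_cons tensDl; apply: (etrans (qpiD _ _ _)); congr (_ + _); last exact: IH.
have -> : << coeff z t *g z >> = coeff z t *: (<< z >> : {freeg (V * W) / R}).
  by apply/eqP/freeg_eqP => y; rewrite coeffZ !coeffU mul1r.
rewrite linearZ_LR !tensZl -tensZr -qpi_one /tens; congr (_ *: qpi _ _).
by case: z.
Qed.

(** The tensor product is [V / IV]. The harder half needs a map out of it, sending [(x, y)] to the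
    class of [repr y *: x]. *)
Lemma tens_cyclic_eq0 (x : V) : tens x one = 0 <-> span IV x.
Proof.
split=> [|h].
  pose psi (q : V * W) : modquot IV := qpi IV ((repr q.2 : R) *: q.1).
  have [L [Llin LU]] : exists L : {freeg (V * W) / R} -> modquot IV,
      linear L /\ forall q, L << q >> = psi q.
    exists (fglift psi); split; first exact: fglift_linear.
    by move=> q; rewrite liftU scale1r.
  have LD s t : L (s + t) = L s + L t by have := Llin 1 s t; rewrite !scale1r.
  have L0 : L 0 = 0 by apply: (@addrI _ (L 0)); rewrite -LD !addr0.
  have LZ a s : L (a *: s) = a *: L s by have := Llin a s 0; rewrite L0 !addr0.
  have LN s : L (- s) = - L s by rewrite -scaleN1r LZ scaleN1r.
  have reprI (f : R^o) : span I (repr (qpi I f) - f).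
    by apply/qpi_eq; rewrite qpi_repr.
  have psi_eq (f h : R) (y : V) : span I ((f : R^o) - h) -> qpi IV (f *: y) = qpi IV (h *: y).
    by move=> hf; apply/qpi_eq; rewrite -scalerBl; exact: span_mulIV.
  have kill t : span (@bilinear_relations R V W) t -> L t = 0.
    move=> ht; apply: (span_min (B := [set s | L s = 0]) _ _ _ ht) => /= [//|a s s' hs hs'|s hs].
      by rewrite LD LZ hs hs' scaler0 addr0.
    case: hs => [|[|[|]]] => -[p [q [y ->]]]; rewrite /= !LD !LN ?LZ !LU /psi /=.
    - by rewrite scalerDr qpiD; zmod_eq.
    - rewrite -[q]qpi_repr -[y]qpi_repr -qpiD.
      rewrite (psi_eq _ (repr q + repr y)); last exact: reprI.
      by rewrite scalerDl qpiD !qpi_repr; zmod_eq.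
    - by rewrite scalerA mulrC -scalerA linearZ_LR subrr.
    - rewrite -[y]qpi_repr -linearZ_LR (psi_eq _ (p * repr y)); last exact: reprI.
      by rewrite -scalerA linearZ_LR qpi_repr subrr.
  rewrite -(linear0 (@qpi _ _ _)) /tens => /qpi_eq; rewrite subr0 => /kill.
  rewrite LU /psi /= => /eqP; rewrite -(linear0 (@qpi _ _ _)) => /eqP/qpi_eq.
  rewrite subr0 => hx; rewrite -[x]scale1r -[1](subKr (repr one)) scalerBl.
  by apply: spanB => //; exact/span_mulIV/reprI.
have t0 : tens (0 : V) one = 0 by rewrite -(scale0r (0 : V)) tensZl scale0r.
apply: (span_min (B := [set y | tens y one = 0]) _ _ _ h) => //=.
  by move=> a p q hp hq; rewrite tensDl tensZl hp hq scaler0 addr0.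
move=> y /IVE[f [z [hf ->]]]; rewrite /= tensZl -tensZr.
have -> : (f : R) *: one = 0.
  rewrite -linearZ_LR -(linear0 (@qpi _ _ I)); apply/qpi_eq.
  by rewrite subr0 /GRing.scale /= mulr1; exact: mem_span.
by rewrite -(scale0r (0 : W)) tensZr scale0r.
Qed.

End CyclicTensor.

(** * Tor as the homology of the resolution modulo variables *)

Section TorHomology.
Context (S : comNzRingType) (k : nat) (n : 'I_k -> nat).
Local Notation R := (polyring S n).
Local Notation Zk := 'rV[int]_k.
Local Notation pgr := (@pregraded S k n).
Local Notation hom := (@polycomp S k n).
Variables (M : gradedmod S n) (F : gfree_resolution M).
Variables (I : set R) (s : seq (vars n)).
Hypothesis I_vars : forall f, I f -> exists q : vars n -> R, f = \sum_(v <- s) q v * var S v.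
Hypothesis vars_I : forall v, v \in s -> I (var S v).

Let gF j : is_graded (F j) := gmodP (F j).
Local Notation one := (qpi (I : set R^o) (1 : R^o)).

Lemma I_varmul (V : lmodType R) f (x : V) : I f -> span (varmul V s) (f *: x).
Proof.
move=> /I_vars[q ->]; rewrite scaler_suml big_seq; apply: span_sum => v vs.
by rewrite mulrC -scalerA; apply: mem_span; exists v, (q v *: x).
Qed.

Lemma varmul_I (V : lmodType R) (y : V) : varmul V s y -> exists f x, I f /\ y = f *: x.
Proof.
by move=> [v [c [vs ->]]]; exists (var S v), c; split; first exact: vars_I.
Qed.

Lemma tens_one_eq0 j (x : F j) : tens x one = 0 <-> span (varmul (F j) s) x.
Proof. exact: (tens_cyclic_eq0 (@I_varmul (F j)) (@varmul_I (F j))). Qed.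

(** A homogeneous class of the cyclic factor comes from a homogeneous polynomial [f], which moves
    across the tensor sign together with its degree. *)
Lemma gtensor_cyclic j a (u : gtensor (F j) (ring_mod I)) : gcomp a u <->
  exists2 x, gcomp a x & u = tens x one.
Proof.
split=> [[l hl ->]|[x hx ->]]; last first.
  exists [:: (x, one)]; last by rewrite big_seq1.
  move=> q; rewrite inE => /eqP -> /=; exists a, 0; split; rewrite ?addr0 //.
  by exists 1 => //; exact: polycomp1.
elim: l hl => [|q l IH] hl.
  exists 0; first exact: (gcomp0 (gF j)).
  by rewrite big_nil -(scale0r (0 : F j)) tensZl scale0r.
have [|x hx ex] := IH; first by move=> q' q'l; apply: hl; rewrite inE q'l orbT.
have [b [c [hq1 [f hf eq2] ea]]] := hl q (mem_head _ _).
exists (f *: q.1 + x).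
  by apply: (gcompD (gF j)) => //; rewrite ea addrC; exact: (gcompZ (gF j)).
rewrite big_cons ex tensDl; congr (_ + _).
by rewrite tensZl -tensZr scale_one eq2.
Qed.

Lemma Supp_Tor j a : Supp (Tor (ring_mod I) F j) a <-> exists x : F j,
  [/\ gcomp a x,
      (if j is j'.+1 return F j -> Prop
       then fun x => span (varmul (F j') s) (res_d F j' x) else fun=> True) x
    & ~ exists y, span (varmul (F j) s) (x - res_d F j y)].
Proof.
have bd (x : F j) : tor_boundaries (N := ring_mod I) (F := F) (tens x one) <->
    exists y, span (varmul (F j) s) (x - res_d F j y).
  have e (y : F j.+1) : tens (x - res_d F j y) one = tens x one - tens (res_d F j y) one.
    by rewrite tensDl -scaleN1r tensZl scaleN1r.
  split=> [[w _]|[y /tens_one_eq0]].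
    have [y ->] := tens_cyclic w; rewrite tensor_map_tens => exy.
    by exists y; apply/tens_one_eq0; rewrite e exy subrr.
  rewrite e => /eqP; rewrite subr_eq0 => /eqP exy.
  by exists (tens y one) => //; rewrite tensor_map_tens.
have cy (x : F j) : tor_cycles (N := ring_mod I) (F := F) (tens x one) <->
    (if j is j'.+1 return F j -> Prop
       then fun x => span (varmul (F j') s) (res_d F j' x) else fun=> True) x.
  case: j x {bd} => [//|j] x; rewrite -tens_one_eq0 -tensor_map_tens.
  by [].
rewrite Supp_homology; first last.
- split=> [|q _ _ [x _ <-] [y _ <-]]; first by exists 0 => //; exact: tensor_map0.
  by exists (q *: x + y) => //; exact: tensor_map_linear.
- case: (j) => [//|j']; split=> [|q x y]; first exact: tensor_map0.
  by rewrite /tor_cycles /= tensor_map_linear => -> ->; rewrite scaler0 addr0.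
split=> [[_ [/gtensor_cyclic[x hx ->] /cy hc nb]]|[x [hx hc nb]]].
  by exists x; split=> // /bd.
exists (tens x one); split; [by apply/gtensor_cyclic; exists x|exact/cy|].
by move=> /bd.
Qed.

Lemma rescomplex_acyclicP b a : acyclic (rescomplex F s b) a <->
  forall j, ~ Supp (Tor (ring_mod I) F j) (b + a).
Proof.
split=> [ac j /Supp_Tor[x [hx hc nb]]|nS u hu du].
- apply: nb; pose u : resprod F := dfwith (fun j => 0 : F j) x.
  have [||v hv zv] := ac u.
  + move=> i; rewrite /u; case: dfwithP => // i' _; exact: (gcomp0 (gF i')).
  + move=> i /=; rewrite /resdif /u.
    have [e|ne] := eqVneq j i.+1; last first.
      by rewrite dfwith_out // linear0; exact: (gvarmul0 (gF i)).
    subst j; rewrite dfwith_in; apply/(gvarmulP (gF i)) => //.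
    exact: res_d_degree0.
  + exists (v j.+1); have := gvarmul_span (zv j).
    by rewrite seqprodD seqprodN /u dfwith_in.
- have ex j : exists y : F j.+1, gcomp (b + a) y /\
      gvarmul (F j) s (b + a) (u j - res_d F j y).
    have [y hy] : exists y, span (varmul (F j) s) (u j - res_d F j y).
      apply: contrapT => nb; apply: (nS j); apply/Supp_Tor; exists (u j).
      split=> //; case: (j) => [//|j'].
      exact: (gvarmul_span (du j')).
    exists (proj (b + a) y); split; first exact: (gcomp_proj (gF _)).
    rewrite -(proj_degree0 (gF _) (gF j) _ _ _ (@res_d_degree0 _ _ _ _ F j));
      last exact: linearP.
    rewrite -[u j](proj_id (gF j) (hu j)) -(projB (gF j)).
    exact: (gvarmul_proj (gF j)).
  pose v : resprod F := fun j => if j is j'.+1 return F j then projT1 (cid (ex j')) else 0.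
  exists v => [j|j].
    by case: j => [|j] /=; [exact: (gcomp0 (gF 0))|case: (cid _) => ? []].
  by rewrite seqprodD seqprodN /= /resdif /v; case: (cid _) => ? [].
Qed.

End TorHomology.

(** * Combinations of a finite family of ring elements *)

Section Combinations.
Context (R : comNzRingType) (I : finType) (x : I -> R).

Definition combination (f : R) := exists q : I -> R, f = \sum_i q i * x i.

Lemma combinationP a f h : combination f -> combination h -> combination (a * f + h).
Proof.
move=> [q ->] [q' ->]; exists (fun i => a * q i + q' i).
by rewrite mulr_sumr -big_split; apply: eq_bigr => i _; rewrite mulrDl mulrA.
Qed.

Lemma combination0 : combination 0.
Proof. by exists (fun=> 0); rewrite big1 // => i _; rewrite mul0r. Qed.

Lemma combination_self i : combination (x i).
Proof.
exists (fun j => (j == i)%:R); rewrite (bigD1 i) //= eqxx mul1r big1 ?addr0 //.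
by move=> j /negbTE ->; rewrite mul0r.
Qed.

Lemma combination_span (A : set R^o) f :
  (forall h, A h -> combination h) -> span A f -> combination f.
Proof.
move=> hA; apply: span_min => [|a u v|]; [exact: combination0|exact: combinationP|exact: hA].
Qed.

End Combinations.

(** * Comparison on the translates of the cone *)

Section Final.
Context (S : comNzRingType) (k : nat) (n : 'I_k -> nat).
Local Notation R := (polyring S n).
Local Notation Zk := 'rV[int]_k.
Local Notation hom := (@polycomp S k n).
Local Notation gr := (@polycomp_gradation S k n).
Local Notation kos s := (koszul (@var S k n) (@vdeg k n) s).
Variables (p : nat) (iota : 'I_p -> 'I_k).

Definition blockvars : seq (vars n) :=
  enum [pred v : vars n | [exists l, iota l == tag v]].

Lemma mem_blockvars v : v \in blockvars -> exists l, iota l = tag v.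
Proof. by rewrite mem_enum => /existsP[l /eqP e]; exists l. Qed.

Lemma sumB_var v : v \in blockvars -> sumB iota (var S v).
Proof.
move=> /mem_blockvars[l]; case: v => i j /= e; subst i.
exists (fun l' => if l' == l then @X_ S k n _ j else 0).
  move=> l'; case: eqP => [->|_]; last exact: span0.
  by apply: mem_span; exists j.
by rewrite -big_mkcond big_pred1_eq.
Qed.

(** Extended by 0 to all variables, so that combinations are indexed by the finite type [vars n]. *)
Definition blockvar v : R := if v \in blockvars then var S v else 0.

Lemma sum_blockvar (q : vars n -> R) :
  \sum_v q v * blockvar v = \sum_(v <- blockvars) q v * var S v.
Proof.
rewrite /blockvars big_enum /= [RHS]big_mkcond; apply: eq_bigr => v _.
by rewrite /blockvar /blockvars mem_enum; case: ifP => // _; rewrite mulr0.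
Qed.

Lemma sumB_combination f : sumB iota f -> combination blockvar f.
Proof.
move=> [h hB ->]; elim/big_ind: _ => [|a b ca cb|l _]; first exact: combination0.
  by rewrite -[a]mul1r; exact: combinationP.
apply: combination_span (hB l) => _ [j _ <-].
have -> : X_ S j = blockvar (Tagged (fun i => 'I_(n i)) j : vars n).
  have jb : (Tagged (fun i => 'I_(n i)) j : vars n) \in blockvars.
    by rewrite mem_enum; apply/existsP; exists l; exact: eqxx.
  by rewrite /blockvar jb.
exact: combination_self.
Qed.

Hypothesis iota_inj : injective iota.

(** The origin of the shift [a_]: block [i] has [n i] variables of degree [e_ i], and injectivity of
    [iota] keeps a block from being counted twice. *)
Lemma sum_vdeg_blockvars : \sum_(v <- blockvars) vdeg v = - a_ n iota.
Proof.
rewrite /a_ opprK /blockvars big_enum /=.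
transitivity (\sum_(i in [set iota l | l in 'I_p]%SET) \sum_(j < n i) (e_ i : Zk)).
  rewrite sig_big_dep; apply: eq_bigl => v; rewrite andbT inE.
  apply/existsP/imsetP => [[l /eqP e]|[l _ e]]; exists l => //.
  by rewrite e.
rewrite big_imset /=; last by move=> ? ? _ _; exact: iota_inj.
by apply: eq_big => // l _; rewrite sumr_const card_ord.
Qed.

Variables (M : gradedmod S n) (F : gfree_resolution M).
Variables (r : nat) (g : 'I_r -> R).
Hypothesis g_homog : forall t, homogeneous (g t).
Hypothesis g_gen : ideal (range g) = sumB iota.

Lemma cone0 : cone iota 0.
Proof. by exists (fun=> 0%N); rewrite big1. Qed.

Lemma cone_add v c : v \in blockvars -> cone iota c -> cone iota (vdeg v + c).
Proof.
move=> /mem_blockvars[l0 e] [m ->]; exists (fun l => (l == l0) + m l)%N.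
rewrite /vdeg -e; under [RHS]eq_bigr do rewrite mulrnDr.
rewrite big_split; congr (_ + _); rewrite (bigD1 l0) //= eqxx mulr1n big1 ?addr0 //.
by move=> l /negbTE ->.
Qed.

(** The common term is the Koszul complex of the Cech complex. [main] matches it with [That] in each
    single degree; the translate of the cone enters only through [koszul_acyclicP]. *)
Lemma That_CC x : (forall a, cone iota (a - x) -> ~ That F iota a) <->
  (forall a, cone iota (a - x) -> ~ CC g M a).
Proof.
have [alpha hg] := choice g_homog.
have gp := gcomp_graded_part (gmodP M).
have g_vars t : exists2 q : vars n -> R,
    forall v, hom (alpha t - vdeg v) (q v) & g t = \sum_(v <- blockvars) q v * var S v.
  have [q eq] : combination blockvar (g t).
    by apply: sumB_combination; rewrite -g_gen; apply: mem_span; exists t.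
  have hb v : hom (vdeg v) (blockvar v).
    by rewrite /blockvar; case: ifP => _; [exact: polycomp_var|exact: polycomp0].
  have [|q' hq' e] := @homogeneous_combination S k n _ (alpha t) _ q _ _ hb.
    by rewrite -eq; exact: hg.
  by exists q' => //; rewrite eq e sum_blockvar.
pose cech := cechquot hom (@gcomp _ _ _ M) g [set: {set 'I_r}]%SET.
have okC : reldiffP hom cech by exact: (cechquotP gr gp hg (@down_closed_setT r)).
(* The [g t] generate the ideal, so each variable is a combination of them and inherits torsion. *)
have tv v : v \in blockvars -> torsion cech (var S v) (vdeg v).
  move=> vb; have [q eq] : combination g (var S v).
    apply: (@combination_span _ _ _ (range g)) => [_ [t _ <-]|]; first exact: combination_self.
    by have := sumB_var vb; rewrite -g_gen.
  have [|q' hq' e] := @homogeneous_combination S k n _ (vdeg v) _ q _ _ hg.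
    by rewrite -eq; exact: polycomp_var.
  rewrite eq e; apply: (torsion_sum gr okC hq' hg) => t.
  exact: (cech_torsion gr gp hg).
have TorE a : (forall j, ~ Supp (Tor (ring_mod (sumB iota)) F j) (- a_ n iota + a)) <->
    ~ That F iota a.
  split=> [nS [b [j _ hb] e]|nT j hj].
    by apply: (nS j); rewrite -e addKr.
  by apply: nT; exists (- a_ n iota + a); [exists j|rewrite addNKr].
have CCE a : (forall q, ~ Supp (local_cohomology g M q) a) <-> ~ CC g M a.
  by split=> [nS [q _ hq]|nC q hq]; [exact: (nS q)|apply: nC; exists q].
have main a : acyclic (kos blockvars cech) a <-> ~ That F iota a.
  rewrite (koszul_cech_augmentation gr gp hg (@polycomp_var S k n) g_vars).
  rewrite -(koszul_augment F hg) koszul_rescomplex; last by rewrite cats0 enum_uniq.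
  rewrite addr0 sum_vdeg_blockvars -TorE; apply: rescomplex_acyclicP.
    move=> f /sumB_combination[q ->]; exists q; rewrite sum_blockvar.
    by apply: perm_big; rewrite perm_sym -[catrev _ _]/(rev _) perm_rev.
  by move=> v; rewrite -[catrev _ _]/(rev _) mem_rev => vb; exact: sumB_var.
have := @koszul_acyclicP _ _ _ gr _ _ _ (@polycomp_var S k n) blockvars cech
  (fun a => cone iota (a - x)) okC.
case=> [v a vb|v|].
- by rewrite -addrA; exact: cone_add.
- exact: tv.
have cE a : acyclic cech a <-> ~ CC g M a.
  by rewrite -CCE; exact: (cech_acyclicP (gmodP M) hg).
move=> h1 h2; split=> h a Ya.
  by apply/cE; apply: h2 => // b Yb; apply/main; exact: h.
by apply/main; apply: h1 => // b Yb; apply/cE; exact: h.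
Qed.

End Final.

(** * From translates to the equality of degree sets *)

Lemma subset_subP (k : nat) (E C : set 'rV[int]_k) x :
  subset_sub E C x <-> exists2 a, E a & C (a - x).
Proof.
split=> [[e Ee [f Cf ->]]|[a Ea Ca]]; first by exists e; rewrite ?subKr.
by exists a => //; exists (a - x); rewrite ?subKr.
Qed.

Lemma cone_orthant (k p : nat) (iota : 'I_p -> 'I_k) c : cone iota c -> orthant c.
Proof.
move=> [m ->] i; rewrite summxE sumr_ge0 // => l _.
by rewrite mulmxnE mulrn_wge0 // mxE ler0n.
Qed.

(** The cone contains 0 and lies in the orthant, which is closed under addition; so the second
    assertion of the theorem follows from the first. *)
Lemma star_cone (k p : nat) (iota : 'I_p -> 'I_k) (E : set 'rV[int]_k) :
  star E = star (subset_sub E (cone iota)).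
Proof.
apply/seteqP; split=> [x [e Ee [f of_ ->]]|x [_ [e Ee [c cc ->]] [f of_ ->]]].
  exists e; last by exists f.
  by exists e => //; exists 0; [exact: cone0|rewrite subr0].
exists e => //; exists (c + f); last by rewrite opprD addrA.
by move=> i; rewrite mxE; apply: addr_ge0; [exact: (cone_orthant cc)|exact: of_].
Qed.

Theorem theorem3p8 (S : comNzRingType) (k : nat) (n : 'I_k -> nat)
    (k_gt0 : (0 < k)%N) (n_gt0 : forall i, (0 < n i)%N)
    (M : gradedmod S n) (F : gfree_resolution M)
    (p : nat) (iota : 'I_p -> 'I_k) (iota_inj : injective iota)
    (r : nat) (g : 'I_r -> polyring S n)
    (g_homog : forall t, homogeneous (g t))
    (g_gen : ideal (range g) = sumB iota) :
  subset_sub (That F iota) (cone iota) = subset_sub (CC g M) (cone iota) /\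
  star (CC g M) = star (That F iota).
Proof.
suff e : subset_sub (That F iota) (cone iota) = subset_sub (CC g M) (cone iota).
  by split=> //; rewrite (star_cone iota) -e -star_cone.
have H := That_CC iota_inj F g_homog g_gen.
apply/seteqP; split=> x /subset_subP[a Ea Ca]; apply/subset_subP; apply: contrapT => none.
  have [_ h] := H x; apply: (h _ a Ca Ea) => b Cb Eb; apply: none; by exists b.
have [h _] := H x; apply: (h _ a Ca Ea) => b Cb Eb; apply: none; by exists b.
Qed.
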